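(* Let $(M,I,\sigma)$ be a compact holomorphic Poisson manifold for which the natural map $H^2(M,\mathbb C)\to H^2(M,\mathcal O)$ is surjective, and let $\omega_1$ be a closed complex 2-form with $\omega_1^{0,2}=0$. Let $\beta(t)$, for $t$ in a neighbourhood of $0\in\mathbb C$, be the holomorphic family of closed complex 2-forms with $\beta(0)=0$ and $\partial_t\beta(0)=\omega_1$ produced by the inductive construction recalled in the context, and let $(I_t,\sigma_t)$ be the resulting family of holomorphic Poisson structures, $L_{\sigma_t}=e^{\beta(t)}L_\sigma$. Then $(I_t,\sigma_t)$ has the following derivative at each time $t$: $$\partial_tI_t=-2i\,\sigma_t(\alpha^{1,1}),\qquad \partial_t\sigma_t=\wedge^2\sigma_t(\alpha^{2,0}),\qquad \overline\partial_t\sigma_t=\overline{\sigma_t}\,\overline{\alpha^{1,1}}\,\sigma_t+\sigma_t\,\overline{\alpha^{1,1}}\,\overline{\sigma_t},$$ where $\alpha=\partial_t\beta$ and the projections to the $(2,0)$ and $(1,1)$ components are taken with respect to the complex structure $I_t$ at time $t$.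
   Context: A holomorphic Poisson manifold $(M,I,\sigma)$ is a smooth manifold with complex structure $I$ and holomorphic bivector $\sigma\in H^0(M,\wedge^2T_{1,0})$ with $[\sigma,\sigma]=0$; $L_\sigma=\{X+\sigma\zeta+\zeta : X\in T_{0,1},\ \zeta\in T_{1,0}^*\}\subset T_{\mathbb C}\oplus T_{\mathbb C}^*$. Bivectors are viewed as maps $T_{\mathbb C}^*\to T_{\mathbb C}$ and 2-forms as maps $T_{\mathbb C}\to T_{\mathbb C}^*$, $\beta X=i_X\beta$; $e^\beta(X+\xi)=X+\xi+\beta X$. In the displayed formulas, $\sigma_t(\alpha^{1,1})$ is the contraction of $\sigma_t$ with $\alpha^{1,1}$, $\wedge^2\sigma_t(\alpha^{2,0})$ is the bivector obtained by applying $\sigma_t$ to both factors of $\alpha^{2,0}$, and the products in the last equation are compositions of maps. $\partial_t,\overline\partial_t$ are the derivatives $\partial/\partial t,\partial/\partial\overline t$ in the complex parameter $t$. Construction of $\beta$: put $\psi(\beta)=(1+\beta\sigma)^{-1}\beta$. Fix a Hermitian metric and a splitting $\mathcal H\subset H^2(M,\mathbb C)$ of the projection to $H^2(M,\mathcal O)$. Set $\beta(t)=\sum_{k\ge1}t^k\beta_k$ with $\beta_1=\omega_1$. Given closed $\beta_1,\dots,\beta_k$ with $\psi(\beta_{\le k})^{0,2}=0$ modulo $t^{k+1}$, where $\beta_{\le k}=t\beta_1+\dots+t^k\beta_k$, write $\psi(\beta_{\le k})^{0,2}=t^{k+1}r_{k+1}$ modulo $t^{k+2}$; then $r_{k+1}\in\Omega^{0,2}$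 is $\overline\partial$-closed. Let $\tilde r_{k+1}$ be the unique harmonic complex 2-form with class in $\mathcal H$ lifting the class of $r_{k+1}$, let $\gamma_{k+1}\in\Omega^{0,1}$ be the unique element in the image of $\overline\partial^*$ with $\tilde r_{k+1}^{0,2}-r_{k+1}=\overline\partial\gamma_{k+1}$, and set $\beta_{k+1}=-\tilde r_{k+1}+d\gamma_{k+1}$. The series converges for small $t$, and $\omega(t)=\psi(\beta(t))$ satisfies $\omega^{0,2}=0$ and the Maurer–Cartan equation $d\omega+\tfrac12[\omega,\omega]_\sigma=0$ for the Koszul bracket of $\sigma$; consequently $e^{\beta(t)}L_\sigma=L_{\sigma_t}$ for a family $(I_t,\sigma_t)$ of holomorphic Poisson structures with $(I_0,\sigma_0)=(I,\sigma)$.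
   Formalization: In the last formula the 2-form factor acts with the sign opposite to X ↦ i_Xα (the same contraction as in the formula for ∂_t I_t); read literally as a composition of maps with βX = i_Xβ, the right-hand side has the wrong sign, as a complex 2-torus example shows. *)

(* Defs.v *)
From HB Require Import structures.
From mathcomp Require Import all_boot all_order all_algebra.
From mathcomp Require Import complex.
From mathcomp Require Import all_classical all_reals all_analysis.

Set Implicit Arguments.
Unset Strict Implicit.
Unset Printing Implicit Defensive.

Import Order.TTheory GRing.Theory Num.Theory.
Import numFieldNormedType.Exports.

Local Open Scope classical_set_scope.
Local Open Scope ring_scope.
Local Open Scope complex_scope.

Fixpoint Ck (R : realType) (m k : nat) (D : set 'cV[R]_m) (f : 'cV[R]_m -> R)
    : Prop :=
  match k with
  | 0 => forall x, D x -> {for x, continuous f}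
  | k'.+1 => forall v : 'cV[R]_m,
      (forall x, D x -> derivable f x v) /\ Ck k' D (fun x => 'D_v f x)
  end.

(* Meaningful for D open. *)
Definition smooth_on (R : realType) (m : nat) (D : set 'cV[R]_m)
    (f : 'cV[R]_m -> R) : Prop := forall k, Ck k D f.

(* [chart_at] only records that the charts cover. *)
Record manifold (R : realType) (m : nat) := Manifold {
  carrier :> topologicalType ;
  chart : Type ;
  dom : chart -> set carrier ;
  chart_map : chart -> carrier -> 'cV[R]_m ;
  point_of : chart -> 'cV[R]_m -> carrier ;
  chart_at : carrier -> chart ;
  chart_atP : forall p, dom (chart_at p) p ;
  dom_open : forall c, open (dom c) ;
  chart_map_open : forall c, open (chart_map c @` dom c) ;
  chart_mapK : forall c p, dom c p -> point_of c (chart_map c p) = p ;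
  chart_map_continuous : forall c, {within dom c, continuous (chart_map c)} ;
  point_of_continuous : forall c,
    {within chart_map c @` dom c, continuous (point_of c)} ;
  transition_smooth : forall c c' k,
    smooth_on (chart_map c @` (dom c `&` dom c'))
              (fun x => chart_map c' (point_of c x) k 0) ;
  manifold_hausdorff : hausdorff_space carrier ;
  manifold_second_countable : @second_countable carrier
}.

Arguments chart {R m} _.
Arguments dom {R m M} _ _ : rename.
Arguments chart_map {R m M} _ _ : rename.
Arguments point_of {R m M} _ _ : rename.
Arguments chart_at {R m M} _ : rename.

Definition toC (R : realType) (m k : nat) (A : 'M[R]_(m, k)) : 'M[R[i]]_(m, k) :=
  map_mx (fun a : R => a%:C) A.

Definition conj_mx (R : realType) (m k : nat) (A : 'M[R[i]]_(m, k))
  : 'M[R[i]]_(m, k) := map_mx (fun z : R[i] => z^*) A.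

(** A tensor field is given classically by its components in every chart,
    subject to the usual transformation law; the values at (c, p) with p
    outside the domain of c are irrelevant.  Vectors and covectors are both
    columns; a 2-form A has components [A i j] = A(e_i, e_j), a bivector P has
    components [P i j] = P(dx_i, dx_j), an endomorphism acts by [*m]. *)

Section Fields.
Variables (R : realType) (m : nat) (M : manifold R m).
Local Notation C := R[i].

Definition field1 := chart M -> M -> 'cV[C]_m.
Definition field2 := chart M -> M -> 'M[C]_m.
Definition rfield2 := chart M -> M -> 'M[R]_m.

Definition pd_re (c : chart M) (i : 'I_m) (f : M -> R) (p : M) : R :=
  'D_(delta_mx i 0) (fun x : 'cV[R]_m => f (point_of c x)) (chart_map c p).

Definition pd (c : chart M) (i : 'I_m) (f : M -> C) (p : M) : C :=
  (pd_re c i (fun q => complex.Re (f q)) p) +i*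
  (pd_re c i (fun q => complex.Im (f q)) p).

Definition grad (c : chart M) (f : M -> C) (p : M) : 'cV[C]_m :=
  \col_i pd c i f p.

(* Jacobian of the change of coordinates from c to c'. *)
Definition jac (c c' : chart M) (p : M) : 'M[R]_m :=
  \matrix_(k, i) pd_re c i (fun q => chart_map c' q k 0) p.

Definition smooth_in (c : chart M) (U : set M) (f : M -> R) : Prop :=
  smooth_on (chart_map c @` (dom c `&` U)) (fun x => f (point_of c x)).

Definition csmooth_in (c : chart M) (U : set M) (f : M -> C) : Prop :=
  smooth_in c U (fun q => complex.Re (f q)) /\
  smooth_in c U (fun q => complex.Im (f q)).

Definition smooth_fun (f : M -> R) : Prop := forall c, smooth_in c setT f.

Definition csmooth_fun_on (U : set M) (f : M -> C) : Prop :=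
  forall c, csmooth_in c U f.

Definition eqf (T : Type) (A B : chart M -> M -> T) : Prop :=
  forall c p, dom c p -> A c p = B c p.

Definition is_form1 (eta : field1) : Prop :=
  (forall c i, csmooth_in c setT (fun q => eta c q i 0)) /\
  (forall c c' p, dom c p -> dom c' p ->
    eta c p = (toC (jac c c' p))^T *m eta c' p).

Definition is_form2 (A : field2) : Prop :=
  [/\ forall c i j, csmooth_in c setT (fun q => A c q i j),
      forall c p, dom c p -> (A c p)^T = - A c p &
      forall c c' p, dom c p -> dom c' p ->
        A c p = (toC (jac c c' p))^T *m A c' p *m toC (jac c c' p)].

Definition is_bivector (P : field2) : Prop :=
  [/\ forall c i j, csmooth_in c setT (fun q => P c q i j),
      forall c p, dom c p -> (P c p)^T = - P c p &
      forall c c' p, dom c p -> dom c' p ->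
        P c' p = toC (jac c c' p) *m P c p *m (toC (jac c c' p))^T].

Definition is_endo (J : rfield2) : Prop :=
  (forall c i j, smooth_in c setT (fun q => J c q i j)) /\
  (forall c c' p, dom c p -> dom c' p ->
    jac c c' p *m J c p = J c' p *m jac c c' p).

Definition d1 (eta : field1) : field2 := fun c p =>
  \matrix_(i, j) (pd c i (fun q => eta c q j 0) p
                  - pd c j (fun q => eta c q i 0) p).

Definition d2 (A : field2) (c : chart M) (p : M) (i j k : 'I_m) : C :=
  pd c i (fun q => A c q j k) p + pd c j (fun q => A c q k i) p
  + pd c k (fun q => A c q i j) p.

Definition closed2 (A : field2) : Prop :=
  forall c p i j k, dom c p -> d2 A c p i j k = 0.

Definition closed_form2 (A : field2) : Prop := is_form2 A /\ closed2 A.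

End Fields.

Section Pointwise.
Variables (R : realType) (m : nat).
Local Notation C := R[i].
Implicit Types (J : 'M[R]_m) (A P : 'M[C]_m).

(* Projections of the complexified tangent space onto T_{1,0} and T_{0,1}. *)
Definition pr10 J : 'M[C]_m := 2%:R^-1 *: (1%:M - 'i *: toC J).
Definition pr01 J : 'M[C]_m := 2%:R^-1 *: (1%:M + 'i *: toC J).

Definition part20 J A : 'M[C]_m := (pr10 J)^T *m A *m pr10 J.
Definition part11 J A : 'M[C]_m :=
  (pr10 J)^T *m A *m pr01 J + (pr01 J)^T *m A *m pr10 J.
Definition part02 J A : 'M[C]_m := (pr01 J)^T *m A *m pr01 J.

(* The map X |-> i_X A from vectors to covectors. *)
Definition form_map A : 'M[C]_m := A^T.

(* The map zeta |-> i_zeta P from covectors to vectors. *)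
Definition biv_map P : 'M[C]_m := P^T.

(* The contraction P(A), an endomorphism: P is applied to the first factor of
   A, i.e. P(a (x) b) = P a (x) b, so [biv_contract P A i j] is the sum over k
   of [P k i * A k j].  Pitfall: as i_X also contracts the first slot of A,
   this is minus [biv_map P *m form_map A].  All three derivative formulas
   hold with P(A); with [biv_map P *m form_map A] in its place, those for I_t
   and for the antiholomorphic derivative of sigma_t change sign. *)
Definition biv_contract P A : 'M[C]_m := biv_map P *m A.

(* P (x) P applied to A: P a /\ P b when A = a /\ b. *)
Definition wedge2 P A : 'M[C]_m := biv_map P *m A *m (biv_map P)^T.

(* L_P, as a set of pairs (vector, covector). *)
Definition Lset J P : set ('cV[C]_m * 'cV[C]_m) :=
  [set w | exists X zeta : 'cV[C]_m,
     [/\ toC J *m X = - 'i *: X, (toC J)^T *m zeta = 'i *: zeta &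
         w = (X + biv_map P *m zeta, zeta)]].

Definition Btransform A (w : 'cV[C]_m * 'cV[C]_m) : 'cV[C]_m * 'cV[C]_m :=
  (w.1, w.2 + form_map A *m w.1).

(* Coefficient of t^j in psi(b) = (1 + b P)^{-1} b, for the polynomial
   b = t b_1 + ... + t^k b_k, as a formal power series in t: since b has no
   constant term, only the terms l <= j of the Neumann series contribute. *)
Definition psi_coef P (b : nat -> 'M[C]_m) (k j : nat) : 'M[C]_m :=
  let B : 'M[{poly C}]_m :=
    \sum_(1 <= a < k.+1) 'X^a *: map_mx polyC (form_map (b a)) in
  (map_mx (fun q : {poly C} => q`_j)
     (\sum_(l < j.+1) (- (B *m map_mx polyC (biv_map P))) ^+ l *m B))^T.

End Pointwise.

Section Complex.
Variables (R : realType) (n : nat) (M : manifold R n.*2).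
Local Notation C := R[i].
Implicit Types (J : rfield2 M) (P : field2 M).

Definition holomorphic_on J (U : set M) (f : M -> C) : Prop :=
  csmooth_fun_on U f /\
  forall c p, dom c p -> U p ->
    (toC (J c p))^T *m grad c f p = 'i *: grad c f p.

(* Integrability is the existence of local holomorphic coordinates. *)
Definition complex_structure J : Prop :=
  [/\ is_endo J,
      forall c p, dom c p -> J c p *m J c p = - 1%:M &
      forall p : M, exists2 U : set M, open U /\ U p &
        exists2 z : 'I_n -> M -> C, forall a, holomorphic_on J U (z a) &
          forall c q, dom c q -> U q ->
            \rank (\matrix_(i, a) pd c i (z a) q) = n].

(* sigma is a holomorphic section of wedge^2 T_{1,0}: it has type (2,0) and
   the bracket sigma(df, dg) of local holomorphic functions is holomorphic.
   The last clause is [sigma, sigma] = 0 in components. *)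
Definition holomorphic_Poisson J P : Prop :=
  [/\ complex_structure J,
      is_bivector P,
      forall c p, dom c p -> toC (J c p) *m P c p = 'i *: P c p,
      forall (U : set M) (f g h : M -> C), open U ->
        holomorphic_on J U f -> holomorphic_on J U g ->
        (forall c p, dom c p -> U p ->
           h p = ((grad c f p)^T *m P c p *m grad c g p) 0 0) ->
        holomorphic_on J U h &
      forall c p i j k, dom c p ->
        \sum_l (P c p i l * pd c l (fun q => P c q j k) p
              + P c p j l * pd c l (fun q => P c q k i) p
              + P c p k l * pd c l (fun q => P c q i j) p) = 0].

Definition form02 J (A : field2 M) : Prop :=
  is_form2 A /\ eqf A (fun c p => part02 (J c p) (A c p)).

Definition form01 J (eta : field1 M) : Prop :=
  is_form1 eta /\ eqf eta (fun c p => (pr01 (J c p))^T *m eta c p).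

Definition dbar01 J (eta : field1 M) : field2 M := fun c p =>
  part02 (J c p) (d1 eta c p).

Definition dbar_closed02 J (A : field2 M) : Prop :=
  forall c p, dom c p -> forall a b e,
    \sum_i \sum_j \sum_k d2 A c p i j k *
      pr01 (J c p) i a * pr01 (J c p) j b * pr01 (J c p) k e = 0.

(* r - s is dbar-exact, i.e. r and s have the same class in H^2(M, O). *)
Definition dbar_cohomologous J (r s : field2 M) : Prop :=
  exists2 eta, form01 J eta & eqf (fun c p => r c p - s c p) (dbar01 J eta).

(* The natural map H^2(M, C) -> H^2(M, O), [a] |-> [a^{0,2}], in terms of
   Dolbeault representatives. *)
Definition to02 J (A : field2 M) : field2 M := fun c p =>
  part02 (J c p) (A c p).

Definition H2_to_H2O_surjective J : Prop :=
  forall r, form02 J r -> dbar_closed02 J r ->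
    exists2 a, closed_form2 a & dbar_cohomologous J (to02 J a) r.

(* A linear subspace of H^2(M, C), given by the closed forms representing its
   elements, mapped isomorphically onto H^2(M, O). *)
Record splitting J (H : field2 M -> Prop) : Prop := Splitting {
  splitting_closed : forall a, H a -> closed_form2 a ;
  splitting_exact : forall a eta, is_form1 eta -> eqf a (d1 eta) ->
    is_form2 a -> H a ;
  splitting_linear : forall (x : C) a b e, H a -> H b -> is_form2 e ->
    eqf e (fun c p => x *: a c p + b c p) -> H e ;
  splitting_surj : forall r, form02 J r -> dbar_closed02 J r ->
    exists2 a, H a & dbar_cohomologous J (to02 J a) r ;
  splitting_inj : forall a, H a ->
    dbar_cohomologous J (to02 J a) (fun _ _ => 0) ->
    exists2 eta, is_form1 eta & eqf a (d1 eta)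
}.

Definition hermitian_metric J (g : rfield2 M) : Prop :=
  [/\ forall c i j, smooth_in c setT (fun q => g c q i j),
      forall c c' p, dom c p -> dom c' p ->
        g c p = (jac c c' p)^T *m g c' p *m jac c c' p,
      forall c p, dom c p -> (g c p)^T = g c p,
      forall c p (v : 'cV[R]_(n.*2)), dom c p -> v != 0 ->
        0 < (v^T *m g c p *m v) 0 0 &
      forall c p, dom c p -> (J c p)^T *m g c p *m J c p = g c p].

End Complex.

(* Iterated Lebesgue integral over R^m; it is applied below to continuous
   functions with compact support only. *)
Fixpoint iterated_integral (R : realType) (m : nat)
    : ('cV[R]_m -> R) -> R :=
  match m with
  | 0 => fun f => f 0
  | m'.+1 => fun f =>
      (\int[lebesgue_measure]_(x in [set: R])
        iterated_integral (fun v : 'cV[R]_m' => f (col_mx (x%:M : 'cV_1) v)))%R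
  end.

Section Harmonic.
Variables (R : realType) (n : nat) (M : manifold R n.*2).
Local Notation C := R[i].

(* vol is integration of smooth functions against the Riemannian volume
   density of g.  On a compact manifold the two clauses determine vol on
   smooth functions, by partitions of unity. *)
Definition riemannian_integral (g : rfield2 M) (vol : (M -> R) -> R) : Prop :=
  (forall (a : R) f h, smooth_fun f -> smooth_fun h ->
     vol (fun p => a * f p + h p) = a * vol f + vol h) /\
  (forall c f (K : set M), smooth_fun f -> compact K -> K `<=` dom c ->
     (forall p, ~ K p -> f p = 0) ->
     vol f = iterated_integral (fun x : 'cV[R]_(n.*2) =>
       \1_(chart_map c @` dom c) x *
       (f (point_of c x) * Num.sqrt (\det (g c (point_of c x)))))).

Variables (g : rfield2 M) (vol : (M -> R) -> R).

Definition inner1 (eta theta : field1 M) (p : M) : C :=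
  let c := chart_at p in
  ((eta c p)^T *m toC (invmx (g c p)) *m conj_mx (theta c p)) 0 0.

Definition inner2 (A B : field2 M) (p : M) : C :=
  let c := chart_at p in
  2%:R^-1 * \tr ((A c p)^T *m toC (invmx (g c p)) *m conj_mx (B c p)
                 *m toC (invmx (g c p))).

Definition cvol (f : M -> C) : C :=
  vol (fun p => complex.Re (f p)) +i* vol (fun p => complex.Im (f p)).

(* theta = d^* A *)
Definition d_adjoint (A : field2 M) (theta : field1 M) : Prop :=
  forall eta, is_form1 eta ->
    cvol (inner2 (d1 eta) A) = cvol (inner1 eta theta).

(* theta = dbar^* u, for u in Omega^{0,2} and theta in Omega^{0,1} *)
Definition dbar_adjoint (J : rfield2 M) (u : field2 M) (theta : field1 M)
  : Prop :=
  forall eta, form01 J eta ->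
    cvol (inner2 (dbar01 J eta) u) = cvol (inner1 eta theta).

Definition harmonic2 (A : field2 M) : Prop :=
  closed_form2 A /\ d_adjoint A (fun _ _ => 0).

Definition in_im_dbar_adjoint (J : rfield2 M) (theta : field1 M) : Prop :=
  form01 J theta /\ exists2 u, form02 J u & dbar_adjoint J u theta.

(* psi(beta_{<= k})^{0,2} = t^(k+1) r modulo t^(k+2) *)
Definition obstruction (J : rfield2 M) (P : field2 M) (b : nat -> field2 M)
    (k : nat) (r : field2 M) : Prop :=
  forall j, (j <= k.+1)%N ->
    eqf (fun c p => part02 (J c p) (psi_coef (P c p) (fun a => b a c p) k j))
        (fun c p => if j == k.+1 then r c p else 0).

(* The entry [b 0] is not used. *)
Definition inductive_construction (J : rfield2 M) (P : field2 M)
    (H : field2 M -> Prop) (omega1 : field2 M) (b : nat -> field2 M) : Prop :=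
  eqf (b 1%N) omega1 /\
  forall k, (0 < k)%N -> exists r rt gamma,
    [/\ form02 J r /\ obstruction J P b k r,
        harmonic2 rt /\ H rt,
        dbar_cohomologous J (to02 J rt) r,
        in_im_dbar_adjoint J gamma /\
          eqf (fun c p => to02 J rt c p - r c p) (dbar01 J gamma) &
        closed_form2 (b k.+1) /\
          eqf (b k.+1) (fun c p => - rt c p + d1 gamma c p)].

End Harmonic.

Section Wirtinger.
Variable R : realType.
Local Notation C := R[i].

Definition open_subset (U : set C) : Prop :=
  forall t, U t -> exists2 e : R, 0 < e & forall s, `|s - t| < e%:C -> U s.

Definition ccvg (u : nat -> C) (l : C) : Prop :=
  ((fun N => complex.Re (u N)) @ \oo --> complex.Re l) /\
  ((fun N => complex.Im (u N)) @ \oo --> complex.Im l).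

(* The value at t of t b_1 + t^2 b_2 + ... is A. *)
Definition power_series_value (m : nat) (b : nat -> 'M[C]_m) (t : C)
    (A : 'M[C]_m) : Prop :=
  forall i j, ccvg (fun N => \sum_(1 <= k < N) t ^+ k * b k i j) (A i j).

Definition cderiv0 (f : R -> C) (l : C) : Prop :=
  is_derive (0 : R) 1 (fun s => complex.Re (f s)) (complex.Re l) /\
  is_derive (0 : R) 1 (fun s => complex.Im (f s)) (complex.Im l).

(* The partial derivatives of F at t with respect to x and y, for t = x + iy,
   are fx and fy. *)
Definition partials (F : C -> C) (t fx fy : C) : Prop :=
  cderiv0 (fun s => F (t + s%:C)) fx /\ cderiv0 (fun s => F (t + 'i * s%:C)) fy.

Definition is_dt (F : C -> C) (t l : C) : Prop :=
  exists fx fy, partials F t fx fy /\ l = 2%:R^-1 * (fx - 'i * fy).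

Definition is_dtbar (F : C -> C) (t l : C) : Prop :=
  exists fx fy, partials F t fx fy /\ l = 2%:R^-1 * (fx + 'i * fy).

Definition is_dt_mx (m : nat) (F : C -> 'M[C]_m) (t : C) (A : 'M[C]_m) : Prop :=
  forall i j, is_dt (fun s => F s i j) t (A i j).

Definition is_dtbar_mx (m : nat) (F : C -> 'M[C]_m) (t : C) (A : 'M[C]_m)
  : Prop := forall i j, is_dtbar (fun s => F s i j) t (A i j).

End Wirtinger.

(* Main.v *)
(** The endomorphism [[I_t, Q_t], [0, - I_t^T]] of TM + T*M, with
    Q_t = -2i (sigma_t - conj sigma_t), is real and has L_{sigma_t} as its
    -i-eigenspace.  So L_{sigma_s} = e^D L_{sigma_t}, with D = beta_s - beta_t
    as a map, becomes two matrix identities at each point,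
      I_s = I_t - Q_s N,   Q_s (1 + W) = Q_t,
    where N = D pr01 + conj D pr10 and
    W = (D - conj D)(sigma_t - conj sigma_t).  As beta is a convergent power
    series, beta_{t+h} = beta_t + h alpha + O(|h|^2); the identities turn this
    into expansions of I_{t+h} and sigma_{t+h} of first order in h and conj h,
    whose coefficients are the Wirtinger derivatives.  The terms that are
    absent from the formulas vanish because I_t^2 = -1 for all t. *)

Require Import Defs.
From HB Require Import structures.
From mathcomp Require Import all_boot all_order all_algebra.
From mathcomp Require Import complex.
From mathcomp Require Import all_classical all_reals all_analysis.
From mathcomp Require Import ring lra.

Set Implicit Arguments.
Unset Strict Implicit.
Unset Printing Implicit Defensive.

Import Order.TTheory GRing.Theory Num.Theory.
Import numFieldNormedType.Exports.
Import ComplexField.Normc.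

Local Open Scope classical_set_scope.
Local Open Scope ring_scope.
Local Open Scope complex_scope.

(** Products, transposes and conjugates become atoms, so an identity between linear combinations of
    matrices is left to [ring] on entries. *)
Ltac mx_abelian :=
  repeat match goal with
  | |- context [mulmx ?A ?B] => move: (mulmx A B) => ?
  | |- context [trmx ?A] => move: (trmx A) => ?
  | |- context [biv_map ?A] => move: (biv_map A) => ?
  | |- context [conj_mx ?A] => move: (conj_mx A) => ?
  | |- context [toC ?A] => move: (toC A) => ?
  end;
  apply/matrixP => ? ?; rewrite !mxE; ring.

(** * Entrywise conjugation of complex matrices *)

Section ConjMx.
Variable R : realType.
Local Notation C := R[i].

Lemma conj_mxM m k l (A : 'M[C]_(m, k)) (B : 'M[C]_(k, l)) :
  conj_mx (A *m B) = conj_mx A *m conj_mx B.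
Proof. exact: map_mxM. Qed.

Lemma conj_mxD m k (A B : 'M[C]_(m, k)) :
  conj_mx (A + B) = conj_mx A + conj_mx B.
Proof. exact: map_mxD. Qed.

Lemma conj_mxN m k (A : 'M[C]_(m, k)) : conj_mx (- A) = - conj_mx A.
Proof. exact: map_mxN. Qed.

Lemma conj_mxZ m k (a : C) (A : 'M[C]_(m, k)) :
  conj_mx (a *: A) = (a^*)%R *: conj_mx A.
Proof. exact: map_mxZ. Qed.

Lemma conj_mx1 m : conj_mx 1%:M = 1%:M :> 'M[C]_m.
Proof. exact: map_mx1. Qed.

Lemma conj_mxK m k (A : 'M[C]_(m, k)) : conj_mx (conj_mx A) = A.
Proof. by apply/matrixP => i j; rewrite !mxE conjcK. Qed.

Lemma conj_tr m k (A : 'M[C]_(m, k)) : conj_mx A^T = (conj_mx A)^T.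
Proof. by rewrite /conj_mx map_trmx. Qed.

Lemma conj_toC m k (A : 'M[R]_(m, k)) : conj_mx (toC A) = toC A.
Proof. by apply/matrixP => i j; rewrite !mxE conjc_real. Qed.

Lemma conjC2V : ((2%:R^-1 : C)^*)%R = 2%:R^-1.
Proof. by rewrite fmorphV rmorph_nat. Qed.

Lemma scale2V (V : lmodType C) (x : V) : (2%:R^-1 : C) *: (x + x) = x.
Proof.
by rewrite -mulr2n -(scaler_nat 2 x) scalerA mulVf ?scale1r ?pnatr_eq0.
Qed.

Lemma mulmx_ext m k (A B : 'M[C]_(m, k)) :
  (forall v : 'cV[C]_k, A *m v = B *m v) -> A = B.
Proof.
move=> AB; apply/matrixP => i j.
by have /matrixP/(_ i 0) := AB (delta_mx j 0); rewrite -!colE !mxE.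
Qed.

End ConjMx.

(** * Linear algebra of a Poisson structure at one point *)

Section PointwiseAlgebra.
Variables (R : realType) (m : nat).
Local Notation C := R[i].
Implicit Types (J : 'M[R]_m) (P : 'M[C]_m).

(** Given skew-symmetry, the last equation places both factors of [P] in T_{1,0}. *)
Definition poisson_point J P : Prop :=
  [/\ J *m J = - 1%:M, P^T = - P & toC J *m P = 'i *: P].

(* The real Poisson tensor Q = -2i (sigma - conj sigma).  The endomorphism
   [[I, Q], [0, - I^T]] of TM + T*M has L_sigma as its -i-eigenspace. *)
Definition real_biv P : 'M[C]_m :=
  (- 2%:R * 'i) *: (biv_map P - conj_mx (biv_map P)).

Variables (J : 'M[R]_m) (P : 'M[C]_m).
Hypothesis JP : poisson_point J P.
Local Notation p := (biv_map P).
Local Notation pb := (conj_mx p).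

Lemma toC_sqr : toC J *m toC J = - 1%:M.
Proof.
case: JP => JJ _ _; rewrite /toC -map_mxM /= JJ.
by rewrite map_mxN map_mx1.
Qed.

Lemma biv_tr : p^T = - p.
Proof. by case: JP => _ PT _; rewrite /biv_map trmxK PT opprK. Qed.

Lemma toC_biv : toC J *m p = 'i *: p.
Proof. by case: JP => _ PT JpP; rewrite /biv_map PT mulmxN JpP scalerN. Qed.

Lemma biv_toC : p *m (toC J)^T = 'i *: p.
Proof.
apply: trmx_inj; rewrite trmx_mul trmxK biv_tr mulmxN toC_biv.
by rewrite [in RHS]linearZ /= biv_tr scalerN.
Qed.

Lemma pr10_biv : pr10 J *m p = p.
Proof.
rewrite /pr10 -scalemxAl mulmxBl mul1mx -scalemxAl toC_biv scalerA mulCii.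
by rewrite scaleN1r opprK scale2V.
Qed.

Lemma pr01_biv : pr01 J *m p = 0.
Proof.
rewrite /pr01 -scalemxAl mulmxDl mul1mx -scalemxAl toC_biv scalerA mulCii.
by rewrite scaleN1r subrr scaler0.
Qed.

Lemma biv_pr10 : p *m (pr10 J)^T = p.
Proof.
apply: trmx_inj; rewrite trmx_mul trmxK biv_tr mulmxN pr10_biv.
by [].
Qed.

Lemma biv_pr01 : p *m (pr01 J)^T = 0.
Proof.
by apply: trmx_inj; rewrite trmx_mul trmxK biv_tr mulmxN pr01_biv trmx0 oppr0.
Qed.

Lemma conj_pr10 : conj_mx (pr10 J) = pr01 J.
Proof.
by rewrite conj_mxZ conj_mxD conj_mx1 conj_mxN conj_mxZ conj_toC conjC2V conjCi
  scaleNr opprK.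
Qed.

Lemma conj_pr01 : conj_mx (pr01 J) = pr10 J.
Proof. by rewrite -conj_pr10 conj_mxK. Qed.

Lemma pr01_conj_biv : pr01 J *m pb = pb.
Proof. by rewrite -conj_pr10 -conj_mxM pr10_biv. Qed.

Lemma pr10_conj_biv : pr10 J *m pb = 0.
Proof. by rewrite -conj_pr01 -conj_mxM pr01_biv /conj_mx map_mx0. Qed.

Lemma conj_biv_pr01 : pb *m (pr01 J)^T = pb.
Proof. by rewrite -conj_pr10 -conj_tr -conj_mxM biv_pr10. Qed.

Lemma conj_biv_pr10 : pb *m (pr10 J)^T = 0.
Proof. by rewrite -conj_pr01 -conj_tr -conj_mxM biv_pr01 /conj_mx map_mx0. Qed.

Lemma toC_conj_biv : toC J *m pb = - 'i *: pb.
Proof. by rewrite -(conj_toC J) -conj_mxM toC_biv conj_mxZ conjCi. Qed.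

Lemma toC_pr01 : toC J *m pr01 J = - 'i *: pr01 J.
Proof.
rewrite /pr01 -scalemxAr mulmxDr mulmx1 -scalemxAr toC_sqr scalerA mulrC.
rewrite -[in RHS]scalerA; congr (_ *: _).
by rewrite scalerDr scalerA mulNr mulCii opprK scale1r scalerN scaleNr addrC.
Qed.

Lemma pr01_toC : pr01 J *m toC J = - 'i *: pr01 J.
Proof.
rewrite -toC_pr01 /pr01 -scalemxAr -scalemxAl mulmxDr mulmxDl mul1mx mulmx1.
by rewrite -scalemxAl -scalemxAr.
Qed.

Lemma pr10_toC : pr10 J *m toC J = 'i *: pr10 J.
Proof.
by rewrite -conj_pr01 -(conj_toC J) -conj_mxM pr01_toC conj_mxZ rmorphN /= conjCi
  opprK.
Qed.

Lemma toC_pr10 : toC J *m pr10 J = 'i *: pr10 J.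
Proof.
by rewrite -conj_pr01 -(conj_toC J) -conj_mxM toC_pr01 conj_mxZ rmorphN /= conjCi
  opprK.
Qed.

Lemma pr10Dpr01 : pr10 J + pr01 J = 1%:M.
Proof.
by rewrite -scalerDr addrACA addNr addr0 scale2V.
Qed.

Lemma conj_real_biv : conj_mx (real_biv P) = real_biv P.
Proof.
rewrite /real_biv conj_mxZ conj_mxD conj_mxN conj_mxK rmorphM /= conjCi.
by rewrite rmorphN rmorph_nat mulrN scaleNr -scalerN opprB.
Qed.

(** [pr10 J] fixes sigma and kills its conjugate, and i/2 is inverse to -2i. Expansions of I and Q
    thus yield one of sigma. *)
Lemma biv_real : p = (2%:R^-1 * 'i) *: (pr10 J *m real_biv P).
Proof.
rewrite -scalemxAr mulmxBr pr10_biv pr10_conj_biv subr0 scalerA.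
suff -> : (2%:R^-1 * 'i : C) * (- 2%:R * 'i) = 1 by rewrite scale1r.
rewrite mulrACA mulCii mulrN1 mulrN opprK mulVf// pnatr_eq0.
Qed.

(** The conjugate of sigma kills the (1,0)-covector zeta, so [real_biv P] acts on zeta as -2i sigma;
    on the summand sigma zeta the eigenvalue is i - 2i = -i. *)
Lemma Lset_eigen (V Z : 'cV[C]_m) : Lset J P (V, Z) ->
  toC J *m V + real_biv P *m Z = - 'i *: V.
Proof.
case=> X [z [JX Jz [-> ->]]] {V Z}.
(* Letting I^T act on [z] gives the factor i, letting it act on [pb] gives -i, so the product
   vanishes. *)
have pbz : pb *m z = 0.
  have : pb *m ((toC J)^T *m z) = pb *m ('i *: z) by rewrite Jz.
  have -> : pb *m ((toC J)^T *m z) = - 'i *: (pb *m z).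
    rewrite mulmxA -(conj_toC J) -conj_tr -conj_mxM biv_toC conj_mxZ conjCi.
    by rewrite scalemxAl.
  rewrite -scalemxAr => /eqP; rewrite scaleNr eq_sym -subr_eq0 opprK -scalerDl.
  rewrite scaler_eq0 => /orP[|/eqP //].
  by rewrite -mulr2n mulrn_eq0 (negPf (neq0Ci _)).
rewrite /real_biv -scalemxAl mulmxBl pbz subr0 mulmxDr JX mulmxA toC_biv.
rewrite -scalemxAl scalerDr -addrA -scalerDl; congr (_ + _ *: _).
ring.
Qed.

Lemma Lset_eigen_conj (V Z : 'cV[C]_m) : Lset J P (V, Z) ->
  toC J *m conj_mx V + real_biv P *m conj_mx Z = 'i *: conj_mx V.
Proof.
move=> /Lset_eigen /(congr1 (@conj_mx R m 1)).
by rewrite conj_mxD !conj_mxM conj_toC conj_real_biv conj_mxZ rmorphN /= conjCi opprK.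
Qed.

(** Together with [Lset_biv] this supplies spanning vectors of L_sigma: T_{0,1} and the graph of
    sigma over the (1,0)-covectors. Testing on them turns eigenvector equations into matrix
    identities. *)
Lemma Lset_pr01 (v : 'cV[C]_m) : Lset J P (pr01 J *m v, 0).
Proof.
exists (pr01 J *m v), 0; split; last by rewrite mulmx0 addr0.
  by rewrite mulmxA toC_pr01 -scalemxAl.
by rewrite mulmx0 scaler0.
Qed.

Lemma Lset_biv (v : 'cV[C]_m) : Lset J P (p *m v, (pr10 J)^T *m v).
Proof.
exists 0, ((pr10 J)^T *m v); split; first by rewrite mulmx0 scaler0.
  by rewrite mulmxA -trmx_mul pr10_toC linearZ /= -scalemxAl.
by rewrite mulmxA biv_pr10 add0r.
Qed.

(* Here [L'] = e^D [L], where [L'] and its conjugate are the eigenspaces of the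
   endomorphism [[J', Q'], [0, - J'^T]]. *)
Variables J' Q' D : 'M[C]_m.
Hypothesis eigen' : forall V Z : 'cV[C]_m, Lset J P (V, Z) ->
  J' *m V + Q' *m (Z + D *m V) = - 'i *: V /\
  J' *m conj_mx V + Q' *m conj_mx (Z + D *m V) = 'i *: conj_mx V.

Let Db := conj_mx D.
Let N := D *m pr01 J + Db *m pr10 J.
Let W := (D - Db) *m (p - pb).

(** The eigenvector equation on T_{0,1} and its conjugate on T_{1,0} determine J' on complementary
    subspaces; they are added using pr10 + pr01 = 1. *)
Lemma transform_complex_structure : J' = toC J - Q' *m N.
Proof.
have E1 : J' *m pr01 J + Q' *m (D *m pr01 J) = - 'i *: pr01 J.
  apply: mulmx_ext => v; have [+ _] := eigen' (Lset_pr01 v).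
  by rewrite add0r mulmxDl -(scalemxAl (- 'i)) !mulmxA.
have E2 : J' *m pr10 J + Q' *m (Db *m pr10 J) = 'i *: pr10 J.
  apply: mulmx_ext => v; have [_] := eigen' (Lset_pr01 (conj_mx v)).
  by rewrite add0r !conj_mxM conj_mxK conj_pr01 mulmxDl -(scalemxAl 'i) !mulmxA.
apply/eqP; rewrite -subr_eq0 opprD opprK addrA; apply/eqP.
rewrite -(mulmx1 J') -(mulmx1 (toC J)) -pr10Dpr01 !mulmxDr toC_pr01 toC_pr10.
rewrite -E1 -E2; mx_abelian.
Qed.

(** The equation on the graph of sigma is added to its conjugate; eliminating J' by the previous
    lemma leaves an equation for Q' alone. *)
Lemma transform_biv : Q' *m (1%:M + W) = real_biv P.
Proof.
have E1 : J' *m p + Q' *m ((pr10 J)^T + D *m p) = - 'i *: p.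
  apply: mulmx_ext => v; have [+ _] := eigen' (Lset_biv v).
  by rewrite mulmxDl -scalemxAl -!mulmxA mulmxDl -!mulmxA.
have E2 : J' *m pb + Q' *m ((pr01 J)^T + Db *m pb) = 'i *: pb.
  apply: mulmx_ext => v; have [_] := eigen' (Lset_biv (conj_mx v)).
  rewrite conj_mxD !conj_mxM conj_mxK conj_tr conj_pr10.
  by rewrite mulmxDl -scalemxAl -!mulmxA mulmxDl -!mulmxA.
(* sigma takes values in T_{1,0}, where [N] is [Db]; its conjugate takes values in T_{0,1}, where
   [N] is [D]. *)
have Np : N *m p = Db *m p.
  by rewrite /N mulmxDl -(mulmxA D) -(mulmxA Db) pr01_biv pr10_biv mulmx0 add0r.
have Npb : N *m pb = D *m pb.
  by rewrite /N mulmxDl -(mulmxA D) -(mulmxA Db) pr01_conj_biv pr10_conj_biv mulmx0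
    addr0.
move: E1 E2; rewrite transform_complex_structure !mulmxBl -!mulmxA Np Npb.
rewrite toC_biv toC_conj_biv => /(congr2 +%R) /[apply] E.
have -> : 1%:M + W = ((pr10 J)^T + D *m p) + ((pr01 J)^T + Db *m pb)
    - Db *m p - D *m pb.
  rewrite -[X in X + W]trmx1 -pr10Dpr01 linearD /= /W mulmxBl !mulmxBr.
  mx_abelian.
have -> : real_biv P = - 'i *: p + 'i *: pb - 'i *: p - - 'i *: pb.
  rewrite /real_biv; mx_abelian.
rewrite -E !mulmxBr !mulmxDr; mx_abelian.
Qed.

End PointwiseAlgebra.

(** * The real-valued modulus on [R[i]] *)

Section Normc.
Variable R : realType.
Local Notation C := R[i].
Implicit Types x y z : C.

Lemma normc_ge0 z : 0 <= normc z.
Proof. by case: z => a b; exact: sqrtr_ge0. Qed.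

Lemma normr_normc z : `|z| = (normc z)%:C.
Proof. by rewrite normc_def; case: z. Qed.

(** With [Im_dev], this lets one modulus bound on a complex remainder control the remainders of both
    real components. *)
Lemma Re_dev x y z (a : R) : complex.Re x - complex.Re y - a * complex.Re z =
  complex.Re (x - y - a%:C * z).
Proof. by case: x y z => [? ?] [? ?] [? ?] /=; rewrite mul0r subr0. Qed.

Lemma Im_dev x y z (a : R) : complex.Im x - complex.Im y - a * complex.Im z =
  complex.Im (x - y - a%:C * z).
Proof. by case: x y z => [? ?] [? ?] [? ?] /=; rewrite mul0r addr0. Qed.

Lemma normc_conj z : normc (z^*)%R = normc z.
Proof. by case: z => a b /=; rewrite sqrrN. Qed.

Lemma normc_real (a : R) : normc a%:C = `|a|.
Proof. by rewrite /= expr0n addr0 sqrtr_sqr. Qed.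

Lemma normc_i : normc ('i : C)%R = 1.
Proof. by rewrite -complexiE /= expr0n expr1n add0r sqrtr1. Qed.

Lemma normcD x y : normc (x + y) <= normc x + normc y.
Proof. exact: (@le_normcD R). Qed.

Lemma normc_opp z : normc (- z) = normc z.
Proof. exact: (@normcN R). Qed.

Lemma normcX z k : normc (z ^+ k) = normc z ^+ k.
Proof.
by elim: k => [|k IH]; rewrite ?expr0 ?normc1// !exprS normcM IH.
Qed.

Lemma normc_sum (T : Type) (r : seq T) (P : pred T) (F : T -> C) :
  normc (\sum_(i <- r | P i) F i) <= \sum_(i <- r | P i) normc (F i).
Proof.
elim/big_ind2 : _ => [|x a y b xa yb|//]; first by rewrite normc0.
by rewrite (le_trans (normcD _ _)) ?lerD.
Qed.

Lemma Re_le_normc z : `|complex.Re z| <= normc z.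
Proof. by case: z => a b /=; rewrite -sqrtr_sqr ler_wsqrtr ?lerDl ?sqr_ge0. Qed.

Lemma Im_le_normc z : `|complex.Im z| <= normc z.
Proof. by case: z => a b /=; rewrite -sqrtr_sqr ler_wsqrtr ?lerDr ?sqr_ge0. Qed.

Lemma normc_le_ReIm z : normc z <= `|complex.Re z| + `|complex.Im z|.
Proof.
rewrite {1}(complexE z) (le_trans (normcD _ _)) //.
by rewrite normcM complexiE normc_i mul1r !normc_real.
Qed.

End Normc.

(** * A submultiplicative matrix norm *)

Section EntryNorm.
Variable R : realType.
Local Notation C := R[i].

(** The entrywise l^1 norm is submultiplicative and invariant under transposition and conjugation,
    so big-O bounds pass through these operations. *)
Definition entry_norm m k (A : 'M[C]_(m, k)) : R :=
  \sum_i \sum_j normc (A i j).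

Lemma entry_norm_ge0 m k (A : 'M[C]_(m, k)) : 0 <= entry_norm A.
Proof. by do 2![apply: sumr_ge0 => ? _]; exact: normc_ge0. Qed.

Lemma entry_norm_ge m k (A : 'M[C]_(m, k)) i j : normc (A i j) <= entry_norm A.
Proof.
rewrite /entry_norm (bigD1 i) //= (bigD1 j) //= -addrA lerDl addr_ge0 //.
  by apply: sumr_ge0 => ? _; exact: normc_ge0.
by do 2![apply: sumr_ge0 => ? _]; exact: normc_ge0.
Qed.

Lemma entry_norm0 m k : entry_norm (0 : 'M[C]_(m, k)) = 0.
Proof. by rewrite /entry_norm big1 // => i _; rewrite big1 // => j _; rewrite mxE normc0. Qed.

Lemma entry_normD m k (A B : 'M[C]_(m, k)) :
  entry_norm (A + B) <= entry_norm A + entry_norm B.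
Proof.
rewrite -big_split /=; apply: ler_sum => i _; rewrite -big_split /=.
by apply: ler_sum => j _; rewrite mxE normcD.
Qed.

Lemma entry_normZ m k a (A : 'M[C]_(m, k)) :
  entry_norm (a *: A) = normc a * entry_norm A.
Proof.
rewrite mulr_sumr; apply: eq_bigr => i _; rewrite mulr_sumr.
by apply: eq_bigr => j _; rewrite mxE normcM.
Qed.

Lemma entry_norm_conj m k (A : 'M[C]_(m, k)) :
  entry_norm (conj_mx A) = entry_norm A.
Proof.
by apply: eq_bigr => i _; apply: eq_bigr => j _; rewrite mxE normc_conj.
Qed.

Lemma entry_norm_tr m k (A : 'M[C]_(m, k)) : entry_norm A^T = entry_norm A.
Proof.
rewrite /entry_norm exchange_big /=.
by apply: eq_bigr => i _; apply: eq_bigr => j _; rewrite mxE.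
Qed.

Lemma entry_normM m k l (A : 'M[C]_(m, k)) (B : 'M[C]_(k, l)) :
  entry_norm (A *m B) <= entry_norm A * entry_norm B.
Proof.
rewrite mulr_suml; apply: ler_sum => i _.
apply: (@le_trans _ _ (\sum_j \sum_s normc (A i s) * normc (B s j))).
  apply: ler_sum => j _; rewrite mxE (le_trans (normc_sum _ _ _)) //.
  by apply: ler_sum => s _; rewrite normcM.
rewrite exchange_big /= mulr_suml; apply: ler_sum => s _.
rewrite -mulr_sumr ler_wpM2l ?normc_ge0 //.
(* The sum over row [s] of [B] is part of the norm of [B], and the other rows contribute
   nonnegatively. *)
rewrite /entry_norm (bigD1 s) //= lerDl.
by do 2![apply: sumr_ge0 => ? _]; exact: normc_ge0.
Qed.

End EntryNorm.

(** * Calculus of first-order expansions in h and conj h *)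

Section Expansion.
Variable R : realType.
Local Notation C := R[i].

(** The clause [d <= 1] makes higher powers of |h| the smaller ones, as [bigO0_weaken] uses. *)
Definition bigO0 (e m k : nat) (F : C -> 'M[C]_(m, k)) : Prop :=
  exists K d : R, [/\ 0 <= K, 0 < d, d <= 1 & forall h, normc h < d ->
    entry_norm (F h) <= K * normc h ^+ e].

Lemma bigO0_local e m k (F G : C -> 'M[C]_(m, k)) (d : R) : 0 < d ->
  (forall h, normc h < d -> G h = F h) -> bigO0 e F -> bigO0 e G.
Proof.
move=> d0 FG [K [d' [K0 d'0 d'1 HF]]]; exists K, (Num.min d d').
split=> //; first by rewrite lt_min d0.
  by rewrite ge_min d'1 orbT.
by move=> h; rewrite lt_min => /andP[hd hd']; rewrite FG ?HF.
Qed.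

Lemma bigO0D e m k (F G : C -> 'M[C]_(m, k)) :
  bigO0 e F -> bigO0 e G -> bigO0 e (fun h => F h + G h).
Proof.
move=> [K [d [K0 d0 d1 HF]]] [K' [d' [K'0 d'0 d'1 HG]]].
exists (K + K'), (Num.min d d').
split; [exact: addr_ge0|by rewrite lt_min d0|by rewrite ge_min d1|].
move=> h; rewrite lt_min => /andP[hd hd'].
by rewrite (le_trans (entry_normD _ _)) // mulrDl lerD ?HF ?HG.
Qed.

Lemma bigO0M e e' m k l (F : C -> 'M[C]_(m, k)) (G : C -> 'M[C]_(k, l)) :
  bigO0 e F -> bigO0 e' G -> bigO0 (e + e') (fun h => F h *m G h).
Proof.
move=> [K [d [K0 d0 d1 HF]]] [K' [d' [K'0 d'0 d'1 HG]]].
exists (K * K'), (Num.min d d').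
split; [exact: mulr_ge0|by rewrite lt_min d0|by rewrite ge_min d1|].
move=> h; rewrite lt_min => /andP[hd hd'].
rewrite (le_trans (entry_normM _ _)) // exprD mulrACA.
by rewrite ler_pM ?HF ?HG ?entry_norm_ge0.
Qed.

Lemma bigO0_weaken e e' m k (F : C -> 'M[C]_(m, k)) :
  (e' <= e)%N -> bigO0 e F -> bigO0 e' F.
Proof.
move=> ee' [K [d [K0 d0 d1 HF]]]; exists K, d; split => // h hd.
rewrite (le_trans (HF _ hd)) // ler_wpM2l //.
by rewrite ler_wiXn2l ?normc_ge0 // (le_trans (ltW hd)).
Qed.

Lemma bigO0_linear m k (a : C -> C) (L : 'M[C]_(m, k)) :
  (forall h, normc (a h) = normc h) -> bigO0 1 (fun h => a h *: L).
Proof.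
move=> ah; exists (entry_norm L), 1; split=> //; first exact: entry_norm_ge0.
by move=> h _; rewrite entry_normZ ah expr1 mulrC.
Qed.

Lemma bigO0_cst m k (L : 'M[C]_(m, k)) : bigO0 0 (fun=> L).
Proof.
exists (entry_norm L), 1; split=> //; first exact: entry_norm_ge0.
by move=> h _; rewrite expr0 mulr1.
Qed.

Lemma bigO0_zero e m k : bigO0 e (fun=> 0 : 'M[C]_(m, k)).
Proof.
exists 0, 1; split=> // h _; by rewrite entry_norm0 mul0r.
Qed.

(* First-order expansion at 0 in h and conj h; L and L' are the two Wirtinger
   derivatives. *)
Definition expansion m k (F : C -> 'M[C]_(m, k)) (A L L' : 'M[C]_(m, k)) :=
  bigO0 2 (fun h => F h - (A + h *: L + (h^*)%R *: L')).

Lemma bigO0_dev m k (L L' : 'M[C]_(m, k)) :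
  bigO0 1 (fun h => h *: L + (h^*)%R *: L').
Proof. by apply: bigO0D; apply: bigO0_linear => // h; rewrite normc_conj. Qed.

Lemma expansion_local m k (F G : C -> 'M[C]_(m, k)) A L L' (d : R) : 0 < d ->
  (forall h, normc h < d -> G h = F h) ->
  expansion F A L L' -> expansion G A L L'.
Proof. by move=> d0 FG; apply: (bigO0_local d0) => h hd; rewrite FG. Qed.

Lemma expansion_cst m k (A : 'M[C]_(m, k)) : expansion (fun=> A) A 0 0.
Proof.
apply: (bigO0_local ltr01) (bigO0_zero 2 m k) => h _.
by rewrite !scaler0 !addr0 subrr.
Qed.

Lemma expansionD m k (F G : C -> 'M[C]_(m, k)) A B L L' N N' :
  expansion F A L L' -> expansion G B N N' ->
  expansion (fun h => F h + G h) (A + B) (L + N) (L' + N').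
Proof.
move=> HF HG; apply: (bigO0_local ltr01) (bigO0D HF HG) => h _.
mx_abelian.
Qed.

Lemma expansionM m k l (F : C -> 'M[C]_(m, k)) (G : C -> 'M[C]_(k, l))
    A B L L' N N' :
  expansion F A L L' -> expansion G B N N' ->
  expansion (fun h => F h *m G h) (A *m B)
    (L *m B + A *m N) (L' *m B + A *m N').
Proof.
move=> HF HG.
have HA := bigO0D (bigO0_cst A) (bigO0_weaken (leq0n _) (bigO0_dev L L')).
have HB := bigO0D (bigO0_cst B) (bigO0_weaken (leq0n _) (bigO0_dev N N')).
have HG0 := bigO0D (bigO0_weaken (leq0n _) HG) HB.
(* With E and E' the remainders of F and G, the remainder of the product is E G + (F - E) E' plus
   the product of the linear parts: three terms of order 2. *)
have H1 := bigO0M HF HG0.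
have H2 := bigO0M HA HG.
have H3 := bigO0M (bigO0_dev L L') (bigO0_dev N N').
apply: (bigO0_local ltr01) (bigO0D (bigO0D H1 H2) H3) => h _ /=.
set E := F h - _; set E' := G h - _.
have -> : F h = E + (A + (h *: L + (h^*)%R *: L')).
  by rewrite /E (addrA A) subrK.
have -> : G h = E' + (B + (h *: N + (h^*)%R *: N')).
  by rewrite /E' (addrA B) subrK.
move: (E) (E') => {}E {}E'.
rewrite !mulmxDr !mulmxDl -?scalemxAr -?scalemxAl !scalerDr.
mx_abelian.
Qed.

Lemma expansionZ m k (F : C -> 'M[C]_(m, k)) a A L L' :
  expansion F A L L' -> expansion (fun h => a *: F h) (a *: A) (a *: L) (a *: L').
Proof.
move=> HF; apply: (bigO0_local ltr01) (bigO0M (bigO0_cst a%:M) HF) => h _.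
rewrite mul_scalar_mx; mx_abelian.
Qed.

Lemma expansion_tr m k (F : C -> 'M[C]_(m, k)) A L L' :
  expansion F A L L' -> expansion (fun h => (F h)^T) A^T L^T L'^T.
Proof.
move=> [K [d [K0 d0 d1 HF]]]; exists K, d; split => // h hd.
rewrite -entry_norm_tr; apply: le_trans (HF _ hd).
by rewrite !(linearD, linearN, linearZ) /= !trmxK.
Qed.

Lemma expansion_conj m k (F : C -> 'M[C]_(m, k)) A L L' :
  expansion F A L L' ->
  expansion (fun h => conj_mx (F h)) (conj_mx A) (conj_mx L') (conj_mx L).
Proof.
move=> [K [d [K0 d0 d1 HF]]]; exists K, d; split => // h hd.
rewrite -entry_norm_conj; apply: le_trans (HF _ hd).
rewrite !(conj_mxD, conj_mxN, conj_mxZ) !conj_mxK conjCK addrAC.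
by rewrite addrAC.
Qed.

(** For h = x u with x > 0 and |u| = 1, dividing the bound by x and letting x tend to 0 gives u L +
    conj u L' = 0. The choices u = 1 and u = i give L + L' = 0 and L - L' = 0. *)
Lemma expansion_eq0 m k (L L' : 'M[C]_(m, k)) :
  expansion (fun=> 0) 0 L L' -> L = 0 /\ L' = 0.
Proof.
move=> [K [d [K0 d0 d1 HF]]].
have aux (u : C) : normc u = 1 -> u *: L + (u^*)%R *: L' = 0.
  move=> u1; apply/matrixP => i j; rewrite [RHS]mxE; apply: eq0_normc.
  apply/eqP; rewrite eq_le normc_ge0 andbT; apply/ler_addgt0Pl => e e0.
  rewrite addr0.
  (* This x is inside the radius and satisfies K x <= e; K + 1 is positive even if K = 0. *)
  pose x := Num.min (d / 2%:R) (e / (K + 1)).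
  have x0 : 0 < x by rewrite lt_min !divr_gt0// ltr_wpDl.
  have nx : normc (x%:C * u) = x.
    by rewrite normcM u1 normc_real mulr1 gtr0_norm.
  have xd : x < d by rewrite /x gt_min ltr_pdivrMr// ltr_pMr ?ltr1n.
  have := HF (x%:C * u); rewrite nx => /(_ xd) H.
  have {H} : x * normc ((u *: L + (u^*)%R *: L') i j) <= K * x ^+ 2.
    apply: le_trans H; apply: le_trans (entry_norm_ge _ i j).
    rewrite -{1}(gtr0_norm x0) -normc_real -normcM -normc_opp.
    have -> : ((x%:C * u)^*)%R = x%:C * (u^*)%R.
      by rewrite rmorphM; congr (_ * _); apply: conjc_real.
    rewrite le_eqVlt; apply/orP; left; apply/eqP; congr normc.
    by rewrite !mxE; ring.
  rewrite expr2 mulrCA ler_pM2l // => /le_trans; apply.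
  have : x * (K + 1) <= e by rewrite -ler_pdivlMr ?ltr_wpDl// ge_min lexx orbT.
  lra.
have := aux 1 (normc1 R); have := aux 'i (normc_i R).
rewrite conjCi rmorph1 !scale1r scaleNr -scalerBr => /eqP.
rewrite scaler_eq0 (negPf (neq0Ci _)) /= subr_eq0 => /eqP ->.
move=> /eqP; rewrite -mulr2n -scaler_nat scaler_eq0 pnatr_eq0 /=.
by move=> /eqP ->.
Qed.

Lemma expansion_unique m k (F : C -> 'M[C]_(m, k)) A L L' N N' :
  expansion F A L L' -> expansion F A N N' -> L = N /\ L' = N'.
Proof.
move=> HF /(expansionZ (-1)) HG; have := expansionD HF HG.
rewrite !scaleN1r subrr => H.
have /expansion_eq0[/subr0_eq -> /subr0_eq ->] //:
  expansion (fun=> 0) 0 (L - N) (L' - N').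
by apply: expansion_local H => [|h _]; rewrite ?ltr01// scaleN1r subrr.
Qed.

Lemma expansion_at0 m k (F : C -> 'M[C]_(m, k)) A L L' :
  expansion F A L L' -> F 0 = A.
Proof.
move=> [K [d [K0 d0 d1]]] /(_ 0); rewrite normc0 => /(_ d0).
rewrite expr0n mulr0 rmorph0 !scale0r !addr0 => H.
apply/subr0_eq/matrixP => i j; rewrite [RHS]mxE; apply: eq0_normc.
apply/eqP; rewrite eq_le normc_ge0 andbT; apply: le_trans H.
exact: entry_norm_ge.
Qed.

(* Q = Q0 - Q0 W + Q W^2, with Q bounded because W is small. *)
Lemma expansion_solve m (Q W : C -> 'M[C]_m) Q0 L L' (d : R) : 0 < d ->
  (forall h, normc h < d -> Q h *m (1%:M + W h) = Q0) ->
  expansion W 0 L L' -> expansion Q Q0 (- (Q0 *m L)) (- (Q0 *m L')).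
Proof.
move=> d0 QW HW.
have HW1 : bigO0 1 W.
  apply: (bigO0_local ltr01) (bigO0D (bigO0_weaken (leqnSn 1) HW) (bigO0_dev L L')).
  by move=> h _; rewrite /= add0r subrK.
have HQ : bigO0 0 Q.
  case: HW1 => [K [d' [K0 d'0 d'1 HK]]].
  have K1 : 0 < K + 1 by rewrite ltr_wpDl.
  (* Below this radius |W| <= 1/2, so |Q| <= |Q0| + |Q|/2, whence the bound 2|Q0|. *)
  pose d2 := Num.min (Num.min d d') (2%:R^-1 / (K + 1)).
  exists (2%:R * entry_norm Q0), d2; split; first by rewrite mulr_ge0 ?entry_norm_ge0.
  - by rewrite !lt_min d0 d'0 /= divr_gt0 // invr_gt0.
  - by rewrite !ge_min d'1 orbT.
  move=> h; rewrite !lt_min => /andP[/andP[hd hd']].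
  rewrite ltr_pdivlMr // => hK; rewrite expr0 mulr1.
  have {}HK := HK h hd'; rewrite expr1 in HK.
  have E : Q h = Q0 + (-1) *: (Q h *m W h).
    by rewrite scaleN1r -(QW h hd) mulmxDr mulmx1 addrK.
  have N1 := entry_normD Q0 ((-1) *: (Q h *m W h)).
  rewrite -E entry_normZ normc_opp normc1 mul1r in N1.
  have N2 := entry_normM (Q h) (W h).
  have N3 : entry_norm (Q h) * entry_norm (W h) <= entry_norm (Q h) * 2%:R^-1.
    rewrite ler_wpM2l ?entry_norm_ge0 // (le_trans HK) //.
    have := normc_ge0 h; nra.
  lra.
(* The remainder of Q is the sum of Q W^2, bounded by [H1], and of -Q0 times the remainder of W,
   bounded by [H2]. *)
have H1 := bigO0M HQ (bigO0M HW1 HW1).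
have H2 := bigO0M (bigO0_cst (- Q0)) HW.
apply: (bigO0_local d0) (bigO0D H1 H2) => h hd.
have E : Q h = Q0 - Q h *m W h by rewrite -(QW h hd) mulmxDr mulmx1 addrK.
have -> : Q h *m (W h *m W h) = Q0 *m W h - (Q0 - Q h).
  have -> : Q0 - Q h = Q h *m W h by rewrite -{1}(QW h hd) mulmxDr mulmx1 addrC addKr.
  by rewrite -{1}(QW h hd) -mulmxA mulmxDl mul1mx mulmxDr addrC addKr.
rewrite add0r mulmxDr mulmxN mulmxDr !mulNmx -!scalemxAr.
mx_abelian.
Qed.

(** * From expansions to Wirtinger derivatives *)

Lemma is_derive_quadratic (g : R -> R) (a K d : R) : 0 < d ->
  (forall s, `|s| < d -> `|g s - g 0 - s * a| <= K * s ^+ 2) ->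
  is_derive (0 : R) 1 g a.
Proof.
move=> d0 Hg.
have H : h^-1 *: (g (h *: 1 + 0) - g 0) @[h --> (0 : R)^'] --> a.
  apply/cvgrPdist_le => e e0.
  (* The sign of [K] is arbitrary, hence the positive constant |K| + 1. *)
  have K1 : 0 < `|K| + 1 by rewrite ltr_wpDl.
  have x0 : 0 < Num.min d (e / (`|K| + 1)) by rewrite lt_min d0 divr_gt0.
  near=> h.
  have h0 : h != 0 by near: h; exact: nbhs_dnbhs_neq.
  have : `|h| < Num.min d (e / (`|K| + 1)).
    near: h; apply: dnbhs0_lt; exact: x0.
  rewrite lt_min => /andP[hd]; rewrite ltr_pdivlMr // => hK.
  rewrite addr0 /GRing.scale /= mulr1.
  have -> : a - h^-1 * (g h - g 0) = - (h^-1 * (g h - g 0 - h * a)).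
    by field.
  rewrite normrN normrM normfV ler_pdivrMl ?normr_gt0 //.
  apply: le_trans (Hg _ hd) _.
  have hh : h ^+ 2 = `|h| * `|h| by rewrite -expr2 real_normK ?num_real.
  rewrite hh.
  have := normr_ge0 h; have := ler_norm K; nra.
by split; [apply/cvg_ex; exists a | apply: cvg_lim].
Unshelve. all: by end_near.
Qed.

(** Along h = u s with s real, conj h = conj u s, so the derivative in s is u L + conj u L'; u = 1
    and u = i give the two partials. *)
Lemma expansion_partials m k (F : C -> 'M[C]_(m, k)) (t : C) A L L' i j :
  expansion (fun h => F (t + h)) A L L' ->
  partials (fun s => F s i j) t ((L + L') i j) (('i *: (L - L')) i j).
Proof.
move=> HF; have F0 := expansion_at0 HF; rewrite addr0 in F0.
have [K [d [K0 d0 d1 HK]]] := HF.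
have aux (u : C) : normc u = 1 ->
    cderiv0 (fun s => F (t + u * s%:C) i j) ((u *: L + (u^*)%R *: L') i j).
  move=> u1.
  have Hb (s : R) : `|s| < d -> normc (F (t + u * s%:C) i j - F (t + u * 0%:C) i j
      - s%:C * (u *: L + (u^*)%R *: L') i j) <= K * s ^+ 2.
    move=> sd; have ns : normc (u * s%:C) = `|s|.
      by rewrite normcM u1 mul1r normc_real.
    have := HK (u * s%:C); rewrite ns real_normK ?num_real // => /(_ sd) H.
    apply: le_trans H; apply: le_trans (entry_norm_ge _ i j).
    rewrite mulr0 addr0 F0.
    have -> : ((u * s%:C)^*)%R = (u^*)%R * s%:C.
      by rewrite rmorphM; congr (_ * _); apply: conjc_real.
    rewrite le_eqVlt; apply/orP; left; apply/eqP; congr normc.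
    by rewrite !mxE; ring.
  split; apply: (is_derive_quadratic d0) => s sd.
    by rewrite Re_dev; apply: le_trans (Re_le_normc _) (Hb s sd).
  by rewrite Im_dev; apply: le_trans (Im_le_normc _) (Hb s sd).
split.
  have := aux 1 (normc1 R); rewrite rmorph1 !scale1r.
  suff -> : (fun s : R => F (t + 1 * s%:C) i j) = (fun s : R => F (t + s%:C) i j) by [].
  by apply/funext => s; rewrite mul1r.
by have := aux 'i (normc_i R); rewrite conjCi scaleNr -scalerBr.
Qed.

(** Since -i times i(L - L') is L - L', the combination of partials in [is_dt] is L; with the
    opposite sign, in [is_dtbar], it is L'. *)
Lemma expansion_is_dt m (F : C -> 'M[C]_m) (t : C) A L L' :
  expansion (fun h => F (t + h)) A L L' -> is_dt_mx F t L.
Proof.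
move=> HF i j; exists ((L + L') i j), (('i *: (L - L')) i j); split.
  exact: expansion_partials HF.
rewrite !mxE (mulrA 'i%R) mulCii; by field.
Qed.

Lemma expansion_is_dtbar m (F : C -> 'M[C]_m) (t : C) A L L' :
  expansion (fun h => F (t + h)) A L L' -> is_dtbar_mx F t L'.
Proof.
move=> HF i j; exists ((L + L') i j), (('i *: (L - L')) i j); split.
  exact: expansion_partials HF.
rewrite !mxE (mulrA 'i%R) mulCii; by field.
Qed.

End Expansion.

(** * Limits and bounds for complex sequences *)

Section ComplexSequences.
Variable R : realType.
Local Notation C := R[i].

Lemma ccvgB (u v : nat -> C) l l' :
  ccvg u l -> ccvg v l' -> ccvg (fun N => u N - v N) (l - l').
Proof.
move=> [ur ui] [vr vi]; split.
  rewrite (_ : complex.Re (l - l') = complex.Re l - complex.Re l'); last first.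
    by case: l l' {ur ui vr vi} => [? ?] [].
  rewrite (_ : (fun N => _) = (fun N => complex.Re (u N) - complex.Re (v N))).
    exact: cvgB.
  by apply/funext => N; case: (u N) (v N) => [? ?] [].
rewrite (_ : complex.Im (l - l') = complex.Im l - complex.Im l'); last first.
  by case: l l' {ur ui vr vi} => [? ?] [].
rewrite (_ : (fun N => _) = (fun N => complex.Im (u N) - complex.Im (v N))).
  exact: cvgB.
by apply/funext => N; case: (u N) (v N) => [? ?] [].
Qed.

Lemma ccvgZ (a : C) (u : nat -> C) l :
  ccvg u l -> ccvg (fun N => a * u N) (a * l).
Proof.
case: a => x y [ur ui]; split.
  rewrite (_ : complex.Re _ = x * complex.Re l - y * complex.Im l); last first.
    by case: l {ur ui}.
  rewrite (_ : (fun N => _) =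
      (fun N => x * complex.Re (u N) - y * complex.Im (u N))).
    by apply: cvgB; apply: cvgMl_tmp.
  by apply/funext => N; case: (u N).
rewrite (_ : complex.Im _ = x * complex.Im l + y * complex.Re l); last first.
  by case: l {ur ui}.
rewrite (_ : (fun N => _) =
    (fun N => x * complex.Im (u N) + y * complex.Re (u N))).
  by apply: cvgD; apply: cvgMl_tmp.
by apply/funext => N; case: (u N).
Qed.

Lemma ccvg_bounded (u : nat -> C) l : ccvg u l ->
  exists M, forall N, normc (u N) <= M.
Proof.
have aux (v : nat -> R) (x : R) : v @ \oo --> x -> exists M, forall N, `|v N| <= M.
  move=> vx; have /cvg_seq_bounded[M [_ HM]] : cvgn v by apply/cvg_ex; exists x.
  by exists (M + 1) => N; apply: HM => //; rewrite ltrDl.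
move=> [/aux[M HM] /aux[M' HM']]; exists (M + M') => N.
by rewrite (le_trans (normc_le_ReIm _)) // lerD.
Qed.

(** The bound passes to the limit in the real and the imaginary part separately, which costs the
    factor 2. *)
Lemma ccvg_norm_le (u : nat -> C) l B : ccvg u l ->
  (forall N, normc (u N) <= B) -> normc l <= B *+ 2.
Proof.
have aux (v : nat -> R) (x : R) : v @ \oo --> x -> (forall N, `|v N| <= B) ->
    `|x| <= B.
  move=> vx HB; have nvx : `|v n| @[n --> \oo] --> `|x| by exact: cvg_norm.
  rewrite -(cvg_lim _ nvx) //; apply: limr_le; first by apply/cvg_ex; exists `|x|.
  exact: nearW.
move=> [ur ui] HB; rewrite (le_trans (normc_le_ReIm _)) // mulr2n lerD //.
  by apply: aux ur _ => N; apply: le_trans (Re_le_normc _) (HB N).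
by apply: aux ui _ => N; apply: le_trans (Im_le_normc _) (HB N).
Qed.

Lemma ccvg_geometric (u : nat -> C) (M q : R) : 0 <= q < 1 ->
  (forall k, normc (u k) <= M * q ^+ k) ->
  exists l, ccvg (fun N => \sum_(0 <= k < N) u k) l.
Proof.
move=> /andP[q0 q1] Hu.
have M0 : 0 <= M by rewrite -[M]mulr1 -(expr0 q) (le_trans _ (Hu 0%N)) ?normc_ge0.
have aux (v : nat -> R) : (forall k, `|v k| <= M * q ^+ k) -> cvgn (series v).
  move=> Hv; apply: normed_cvg; apply: (@series_le_cvg _ _ (geometric M q)) => //.
  - by move=> n; exact: normr_ge0.
  - by move=> n; rewrite /geometric /= mulr_ge0 ?exprn_ge0.
  - by apply: is_cvg_geometric_series; rewrite ger0_norm.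
have /cvg_ex[x Hx] := aux (fun k => complex.Re (u k))
  (fun k => le_trans (Re_le_normc _) (Hu k)).
have /cvg_ex[y Hy] := aux (fun k => complex.Im (u k))
  (fun k => le_trans (Im_le_normc _) (Hu k)).
exists (x +i* y); split=> /=.
  rewrite (_ : (fun N => _) = series (fun k => complex.Re (u k))) //.
  by apply/funext => N; rewrite /series /=; apply: (big_morph _ (fun a b => _) _) => //; case=> [? ?] [].
rewrite (_ : (fun N => _) = series (fun k => complex.Im (u k))) //.
by apply/funext => N; rewrite /series /=; apply: (big_morph _ (fun a b => _) _) => //; case=> [? ?] [].
Qed.

Lemma geometric_sum_le (q : R) N : 0 <= q < 1 ->
  \sum_(0 <= k < N) q ^+ k <= (1 - q)^-1.
Proof.
move=> /andP[q0 q1]; rewrite -div1r ler_pdivlMr ?subr_gt0 //.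
suff -> : (\sum_(0 <= k < N) q ^+ k) * (1 - q) = 1 - q ^+ N.
  by rewrite gerBl exprn_ge0.
elim: N => [|N IH]; first by rewrite big_geq // mul0r expr0 subrr.
by rewrite big_nat_recr //= mulrDl IH exprS; ring.
Qed.

End ComplexSequences.

(** * First-order expansion of a convergent power series *)

Section PowerSeries.
Variable R : realType.
Local Notation C := R[i].

(** The second-order Taylor remainder of the k-th power, over a general ring because complex
    remainders are compared with real ones. At k = 0 the exponent [k.-1] is harmless, being
    multiplied by 0. *)
Definition pow_rem (K : comPzRingType) (x h : K) k : K :=
  (x + h) ^+ k - x ^+ k - h * (k%:R * x ^+ k.-1).

Lemma pow_remS (K : comPzRingType) (x h : K) k :
  pow_rem x h k.+1 = (x + h) * pow_rem x h k + h ^+ 2 * (k%:R * x ^+ k.-1).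
Proof.
rewrite /pow_rem /=; case: k => [|k] /=; first by rewrite !expr0 expr1; ring.
by rewrite !exprS -addn1 natrD -[in LHS]addn1 natrD; ring.
Qed.

Lemma pow_rem_ge0 (x h : R) k : 0 <= x -> 0 <= h -> 0 <= pow_rem x h k.
Proof.
move=> x0 h0; elim: k => [|k IH]; first by rewrite /pow_rem !expr0 mul0r mulr0 !subr0 subrr.
rewrite pow_remS; apply: addr_ge0; apply: mulr_ge0 => //.
- exact: addr_ge0.
- exact: exprn_ge0.
- by rewrite mulr_ge0 ?exprn_ge0.
Qed.

Lemma normc_nat k : normc (k%:R : C) = k%:R.
Proof. by rewrite -(rmorph_nat (@real_complex R)) normc_real normr_nat. Qed.

(** By [pow_remS], the remainder divided by h^2 is a polynomial in t and h with nonnegative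
    coefficients, hence is dominated by its value at |t| and eta. Clearing denominators covers h =
    0. *)
Lemma pow_rem_le (t h : C) (eta : R) k : 0 < eta -> normc h <= eta ->
  normc (pow_rem t h k) * eta ^+ 2 <= normc h ^+ 2 * pow_rem (normc t) eta k.
Proof.
move=> eta0 he; elim: k => [|k IH].
  by rewrite /pow_rem !expr0 !mul0r !mulr0 !subr0 !subrr normc0 mul0r mulr0.
rewrite !pow_remS [leRHS]mulrDr.
apply: (@le_trans _ _ ((normc (t + h) * normc (pow_rem t h k)
    + normc h ^+ 2 * (k%:R * normc t ^+ k.-1)) * eta ^+ 2)).
  rewrite ler_wpM2r ?sqr_ge0 // (le_trans (normcD _ _)) //.
  by rewrite (normcM (t + h)) (normcM (h ^+ 2)) (normcM k%:R) !normcX normc_nat.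
rewrite mulrDl lerD //; last by rewrite -mulrA (mulrC _ (eta ^+ 2)).
rewrite -mulrA [leRHS]mulrCA.
apply: ler_pM => //; first exact: normc_ge0.
  by rewrite mulr_ge0 ?normc_ge0 ?sqr_ge0.
by rewrite (le_trans (normcD _ _)) // lerD2l.
Qed.

(* The terms at a point of modulus |t| + 2 eta are bounded, so the remainders
   at t + h, |h| <= eta, are dominated by a geometric series. *)
Lemma power_series_expansion (a : nat -> C) (f : C -> C) (t : C) (e : R) :
  0 < e ->
  (forall s, normc (s - t) < e ->
     ccvg (fun N => \sum_(1 <= k < N) s ^+ k * a k) (f s)) ->
  exists l K d, [/\ 0 <= K, 0 < d, d <= 1 & forall h, normc h < d ->
    normc (f (t + h) - f t - h * l) <= K * normc h ^+ 2].
Proof.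
move=> e0 Hf.
(* The third of [e] ensures 2 eta < e, and the bound 1 lets eta serve as the radius. *)
pose eta := Num.min (e / 3%:R) 1.
have eta0 : 0 < eta by rewrite lt_min ltr01 divr_gt0.
have eta0' := ltW eta0.
have eta1 : eta <= 1 by rewrite ge_min lexx orbT.
have eta2 : eta *+ 2 < e.
  have : eta <= e / 3%:R by rewrite ge_min lexx.
  rewrite ler_pdivlMr // mulr2n; lra.
pose rho := normc t + eta; pose rho' := normc t + eta *+ 2.
have nt0 := normc_ge0 t.
have rho0 : 0 < rho by rewrite /rho; lra.
have rho'0 : 0 < rho' by rewrite /rho' mulr2n; lra.
(* The witness is t moved outwards along its own ray by 2 eta; for t = 0 the positive real direction
   is taken. *)
have [s0 [s0t ns0]] : exists s0 : C, normc (s0 - t) < e /\ normc s0 = rho'.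
  have [t0|tn0] := eqVneq t 0.
    exists (eta *+ 2)%:C; rewrite /rho' t0 subr0 normc_real.
    by rewrite (normc0 R) add0r gtr0_norm ?mulrn_wgt0.
  have nt : normc t != 0 by apply: contraNneq tn0 => /eq0_normc ->.
  exists (t + (eta *+ 2 / normc t)%:C * t); split.
    rewrite addrC addKr normcM normc_real ger0_norm; last first.
      by rewrite divr_ge0 ?mulrn_wge0.
    by rewrite divfK.
  rewrite -{1}[t]mul1r -mulrDl normcM -(rmorph1 (@real_complex R)) -rmorphD.
  rewrite normc_real ger0_norm; last by rewrite addr_ge0 ?divr_ge0 ?mulrn_wge0.
  by rewrite mulrDl mul1r divfK.
have [M0 HM0] := ccvg_bounded (Hf _ s0t).
pose M := M0 *+ 2.
(* A term is the difference of two consecutive partial sums, each bounded by [M0]. *)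
have HM k : (0 < k)%N -> normc (a k) * rho' ^+ k <= M.
  move=> k0; rewrite mulrC -ns0 -normcX -normcM.
  have -> : s0 ^+ k * a k = \sum_(1 <= j < k.+1) s0 ^+ j * a j
      - \sum_(1 <= j < k) s0 ^+ j * a j.
    by rewrite big_nat_recr //= addrAC subrr add0r.
  by rewrite (le_trans (normcD _ _)) // normc_opp /M mulr2n lerD.
have M0' : 0 <= M.
  by apply: le_trans (HM 1%N isT); rewrite mulr_ge0 ?normc_ge0 ?exprn_ge0 ?ltW.
pose q := rho / rho'.
have q01 : 0 <= q < 1.
  by rewrite divr_ge0 ?ltW //= ltr_pdivrMr // mul1r /rho /rho' mulr2n; lra.
have Ha k : (0 < k)%N -> normc (a k) * rho ^+ k <= M * q ^+ k.
  move=> k0; rewrite /q expr_div_n mulrA ler_pdivlMr ?exprn_gt0 //.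
  by rewrite mulrAC ler_wpM2r ?exprn_ge0 ?HM // ltW.
have rem_le k : pow_rem (normc t) eta k <= rho ^+ k.
  rewrite /pow_rem -/rho -addrA gerDl -opprD oppr_le0.
  by rewrite addr_ge0 ?mulr_ge0 ?exprn_ge0 // ltW.
(* Nonnegativity of the remainder at |t| and eta says that the linear term is at most rho^k -
   |t|^k. *)
have der_le k : eta * (k%:R * normc t ^+ k.-1) <= rho ^+ k.
  have := pow_rem_ge0 k nt0 (ltW eta0); rewrite /pow_rem -/rho.
  have := exprn_ge0 k nt0; lra.
(* The derivative is the sum of the termwise derivatives. Starting at k = 0 adds a zero term and
   fits [ccvg_geometric]. *)
have [l Hl] : exists l, ccvg (fun N => \sum_(0 <= k < N)
    (k%:R * t ^+ k.-1) * a k) l.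
  apply: (@ccvg_geometric _ _ (M / eta) q) => // -[|k].
    by rewrite !mul0r (normc0 R) expr0 mulr1 divr_ge0.
  rewrite [leRHS]mulrAC ler_pdivlMr // !normcM normc_nat normcX.
  apply: le_trans (Ha k.+1 isT); rewrite mulrC mulrA [leRHS]mulrC.
  by rewrite ler_wpM2r ?normc_ge0.
pose K := M / eta ^+ 2 * (1 - q)^-1.
have K0 : 0 <= K.
  rewrite !mulr_ge0 ?invr_ge0 ?exprn_ge0 ?(ltW eta0) // subr_ge0 ltW //.
  by case/andP: q01.
exists l, (K *+ 2), eta; split=> //; first by rewrite mulrn_wge0.
move=> h he; rewrite mulrnAl.
have Hth : normc (t + h - t) < e.
  rewrite addrC addKr (lt_trans he) // (le_lt_trans _ eta2) // mulr2n; lra.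
have Htt : normc (t - t) < e by rewrite subrr normc0.
(* It suffices to bound the partial sums of the remainder uniformly in N. *)
apply: ccvg_norm_le (ccvgB (ccvgB (Hf _ Hth) (Hf _ Htt)) (ccvgZ h Hl)) _ => N.
have -> : \sum_(1 <= k < N) (t + h) ^+ k * a k - \sum_(1 <= k < N) t ^+ k * a k
    - h * (\sum_(0 <= k < N) k%:R * t ^+ k.-1 * a k)
    = \sum_(1 <= k < N) pow_rem t h k * a k.
  have -> : \sum_(0 <= k < N) k%:R * t ^+ k.-1 * a k =
      \sum_(1 <= k < N) k%:R * t ^+ k.-1 * a k.
    case: N => [|N]; first by rewrite !big_geq.
    by rewrite big_nat_recl //= !mul0r add0r [RHS]big_add1.
  rewrite mulr_sumr -!sumrB; apply: eq_bigr => k _.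
  by rewrite /pow_rem; ring.
rewrite (le_trans (normc_sum _ _ _)) //.
have -> : K * normc h ^+ 2 = M / eta ^+ 2 * normc h ^+ 2 * (1 - q)^-1.
  by rewrite /K mulrAC.
apply: le_trans (_ : \sum_(1 <= k < N) M / eta ^+ 2 * normc h ^+ 2 * q ^+ k <= _).
  rewrite big_nat_cond [leRHS]big_nat_cond; apply: ler_sum => k /andP[/andP[k0 _] _].
  rewrite normcM.
  have H1 := pow_rem_le t k eta0 (ltW he).
  rewrite -ler_pdivlMr ?exprn_gt0 // in H1.
  apply: le_trans (ler_wpM2r (normc_ge0 _) H1) _.
  have -> : M / eta ^+ 2 * normc h ^+ 2 * q ^+ k =
    normc h ^+ 2 / eta ^+ 2 * (M * q ^+ k) by ring.
  apply: le_trans (ler_wpM2l _ (Ha k k0)); last by rewrite divr_ge0 ?sqr_ge0.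
  have -> : normc h ^+ 2 * pow_rem (normc t) eta k / eta ^+ 2 * normc (a k) =
    normc h ^+ 2 / eta ^+ 2 * (normc (a k) * pow_rem (normc t) eta k) by ring.
  by rewrite ler_wpM2l ?divr_ge0 ?sqr_ge0 // ler_wpM2l ?normc_ge0.
rewrite -mulr_sumr ler_wpM2l ?mulr_ge0 ?invr_ge0 ?normc_ge0 ?sqr_ge0 //.
apply: le_trans (geometric_sum_le N q01).
case: N => [|N]; first by rewrite !big_geq.
by rewrite [leRHS]big_nat_recl //= big_add1 expr0 lerDr.
Qed.

Lemma bigO0_sum e m k (T : Type) (r : seq T) (F : T -> C -> 'M[C]_(m, k)) :
  (forall i, bigO0 e (F i)) -> bigO0 e (fun h => \sum_(i <- r) F i h).
Proof.
move=> HF; elim: r => [|i r IH].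
  by apply: (bigO0_local ltr01) (bigO0_zero R e m k) => h _; rewrite big_nil.
by apply: (bigO0_local ltr01) (bigO0D (HF i) IH) => h _; rewrite big_cons.
Qed.

(** The conj h coefficient is 0 because a power series is holomorphic. The scalar remainders are
    assembled along matrix units. *)
Lemma power_series_mx_expansion m (b : nat -> 'M[C]_m) (B : C -> 'M[C]_m)
    (t : C) (e : R) : 0 < e ->
  (forall s, normc (s - t) < e -> power_series_value b s (B s)) ->
  exists L, expansion (fun h => B (t + h)) (B t) L 0.
Proof.
move=> e0 HB.
have Hl i j : exists l, bigO0 2 (fun h => (B (t + h) i j - B t i j - h * l)
    *: (delta_mx i j : 'M[C]_m)).
  have [||l [K [d [K0 d0 d1 HK]]]] :=
    @power_series_expansion (fun k => b k i j) (fun s => B s i j) t e => //.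
    by move=> s /HB; apply.
  exists l, (K * entry_norm (delta_mx i j : 'M[C]_m)), d; split=> //.
    by rewrite mulr_ge0 ?entry_norm_ge0.
  by move=> h hd; rewrite entry_normZ mulrAC ler_wpM2r ?entry_norm_ge0 ?HK.
exists (\matrix_(i, j) projT1 (cid (Hl i j))).
have := @bigO0_sum 2 m m _ (index_enum _) _ (fun i => @bigO0_sum 2 m m _ (index_enum _) _
  (fun j => projT2 (cid (Hl i j)))).
apply: (bigO0_local ltr01) => h _; rewrite [LHS]matrix_sum_delta.
apply: eq_bigr => i _; apply: eq_bigr => j _; congr (_ *: _).
by rewrite !mxE; ring.
Qed.

End PowerSeries.

(** * Matrix identities behind the formulas: [K] stands for I_t, [p] for sigma_t, [a] for alpha,
    [q10] and [q01] for the projections *)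

Section DerivativeAlgebra.
Variables (R : realType) (m : nat).
Local Notation C := R[i].
Local Notation i := ('i : C)%R.
Variables (K p pb q10 q01 a ab X : 'M[C]_m).
Local Notation s := (p - pb).
Local Notation Q := ((- 2%:R * i) *: s).

Lemma half_i : 2%:R^-1 * (- i * (- 2%:R * i)) = -1.
Proof. by rewrite -mulCii; field. Qed.

Lemma half_i' : 2%:R^-1 * i * (- 2%:R * i) = 1.
Proof. by rewrite -[RHS]opprK -mulCii; field. Qed.

(** K acts on [p] by i and on [pb] by -i, while X K = -i X. In the anticommutator the [p] terms
    cancel and the [pb] terms add up to 4 pb X. *)
Lemma anticommuting_derivative : K *m p = i *: p -> K *m pb = - i *: pb ->
  X *m K = - i *: X -> Q *m X *m K + K *m (Q *m X) = 0 -> pb *m X = 0.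
Proof.
move=> Kp Kpb XK.
have E1 : Q *m X *m K = (- i * (- 2%:R * i)) *: (s *m X).
  by rewrite -mulmxA XK -scalemxAr -scalemxAl scalerA.
have E2 : K *m (Q *m X) = (- 2%:R * i * i) *: ((p + pb) *m X).
  rewrite -scalemxAl -scalemxAr (mulmxA K) mulmxBr Kp Kpb scaleNr opprK.
  by rewrite -scalerDr -scalemxAl scalerA.
have c1 : - i * (- 2%:R * i) = - 2%:R 
  by rewrite (_ : _ * _ = 2%:R * (i * i)); [rewrite mulCii mulrN1 | ring].
have c2 : - 2%:R * i * i = 2%:R by rewrite -mulrA mulCii mulrN1 opprK.
rewrite {}E1 {}E2 {}c1 {}c2 mulmxBl mulmxDl.
move: (p *m X) (pb *m X) => Y Z E.
have : (4%:R : C) *: Z = 0 by rewrite -E; mx_abelian.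
by move/eqP; rewrite scaler_eq0 pnatr_eq0 => /eqP.
Qed.

Hypotheses (q10p : q10 *m p = p) (q10pb : q10 *m pb = 0).
Hypotheses (q01p : q01 *m p = 0) (q01pb : q01 *m pb = pb).
Hypotheses (pbaq : pb *m a *m q01 = 0) (pabq : p *m ab *m q10 = 0).

Lemma half_derivative10 :
  2%:R^-1 *: (0 + - i *: (Q *m (a *m q01))) = - (p *m a *m q01).
Proof.
rewrite add0r -scalemxAl !scalerA half_i mulmxBl !mulmxA pbaq subr0.
by rewrite scaleN1r.
Qed.

Lemma half_derivative01 :
  2%:R^-1 *: (0 + - i *: (Q *m (ab *m q10))) = pb *m ab *m q10.
Proof.
rewrite add0r -scalemxAl !scalerA half_i mulmxBl !mulmxA pabq sub0r.
by rewrite scaleN1r opprK.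
Qed.

(** The left side is the product rule for sigma = (i/2) pr10 Q. The derivative of pr10 contributes p
    a pb, that of Q contributes p a (p - pb), and the mixed terms cancel. *)
Lemma biv_derivative : (2%:R^-1 * i) *:
  (- (p *m a *m q01) *m Q + q10 *m (Q *m (a *m s))) = p *m a *m p.
Proof.
rewrite -scalemxAr -scalemxAl -scalemxAr -scalerDr scalerA half_i' scale1r.
rewrite (mulmxA q10) (mulmxBr q10) q10p q10pb subr0 mulNmx -!mulmxA.
rewrite (mulmxBr q01) q01p q01pb sub0r !mulmxN opprK -!mulmxDr.
by rewrite [pb + _]addrC subrK.
Qed.

(** The same product rule for the conj h coefficient; the unwanted term p ab p vanishes by [pabq],
    since p = q10 p. *)
Lemma biv_derivative_conj : (2%:R^-1 * i) *:
  (pb *m ab *m q10 *m Q + q10 *m - (Q *m (ab *m s)))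
  = pb *m ab *m p + p *m ab *m pb.
Proof.
have pabp : p *m ab *m p = 0 by rewrite -[X in _ *m X]q10p mulmxA pabq mul0mx.
rewrite -scalemxAr -scalemxAl -scalerN -scalemxAr -scalerDr scalerA half_i'.
rewrite scale1r mulmxN (mulmxA q10) (mulmxBr q10) q10p q10pb subr0.
rewrite -!mulmxA (mulmxBr q10) q10p q10pb subr0 !(mulmxBr ab) mulmxBr.
by rewrite !mulmxA pabp sub0r opprK.
Qed.

Variables (t10 t01 : 'M[C]_m).
Hypotheses (pt10 : p *m t10 = p) (pt01 : p *m t01 = 0).
Hypotheses (pbt01 : pb *m t01 = pb) (pbt10 : pb *m t10 = 0).

(** sigma annihilates (0,1)-covectors, so only the summand with a (1,0) first factor survives. *)
Lemma biv_mul11 : p *m (t10 *m a *m q01 + t01 *m a *m q10) = p *m a *m q01.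
Proof. by rewrite mulmxDr !mulmxA pt10 pt01 !mul0mx addr0. Qed.

Lemma biv_mul11_conj :
  pb *m (t01 *m ab *m q10 + t10 *m ab *m q01) *m p
  + p *m (t01 *m ab *m q10 + t10 *m ab *m q01) *m pb
  = pb *m ab *m p + p *m ab *m pb.
Proof.
rewrite !mulmxDr !mulmxA pt10 pt01 pbt01 pbt10 !mul0mx addr0 add0r.
by rewrite -!mulmxA q10p q01pb.
Qed.

Lemma biv_mul20 (ap : p^T = - p) : - (p *m a *m p) =
  p *m (t10 *m a *m q10) *m p^T.
Proof. by rewrite ap !mulmxN !mulmxA pt10 -!mulmxA q10p. Qed.

End DerivativeAlgebra.

(** * Expansions of I and sigma along a family obtained by B-transforms *)

Section PoissonFamily.
Variables (R : realType) (m : nat).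
Local Notation C := R[i].

Lemma expansion_eq k l (F : C -> 'M[C]_(k, l)) A A1 L L1 L' L1' :
  expansion F A L L' -> A = A1 -> L = L1 -> L' = L1' -> expansion F A1 L1 L1'.
Proof. by move=> HF <- <- <-. Qed.

Variables (J : C -> 'M[R]_m) (P B : C -> 'M[C]_m) (t : C) (d : R).
Variables (L0 : set ('cV[C]_m * 'cV[C]_m)) (a : 'M[C]_m).
Hypothesis d0 : 0 < d.
Hypothesis JP : forall h, normc h < d -> poisson_point (J (t + h)) (P (t + h)).
Hypothesis BT : forall h, normc h < d -> (B (t + h))^T = - B (t + h).
Hypothesis LB : forall h, normc h < d ->
  Lset (J (t + h)) (P (t + h)) = Btransform (B (t + h)) @` L0.
Hypothesis Ba : expansion (fun h => B (t + h)) (B t) a 0.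

Local Notation p := (biv_map (P t)).
Local Notation pb := (conj_mx p).
Local Notation ab := (conj_mx a).
Local Notation Jt := (J t).

Let D h := form_map (B (t + h)) - form_map (B t).
Let N h := D h *m pr01 Jt + conj_mx (D h) *m pr10 Jt.
Let W h := (D h - conj_mx (D h)) *m (p - pb).

Let JPt : poisson_point Jt (P t).
Proof. by have := JP (h := 0); rewrite addr0 (normc0 R); apply. Qed.

(** Uniqueness of expansions transfers skew-symmetry from [B] to its derivative. *)
Lemma derivative_antisym : a^T = - a.
Proof.
have H : expansion (fun h => (B (t + h))^T) (B t)^T a^T 0^T.
  exact: expansion_tr Ba.
have {H} H : expansion (fun h => (-1) *: B (t + h)) (B t)^T a^T 0^T.
  by apply: expansion_local d0 _ H => h hd; rewrite scaleN1r BT.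
have H' := expansionZ (-1) Ba.
have BTt : (B t)^T = (-1) *: B t.
  by have := BT (h := 0); rewrite addr0 (normc0 R) scaleN1r; apply.
by rewrite BTt in H; have [-> _] := expansion_unique H H'; rewrite scaleN1r.
Qed.

(** Both subspaces are B-transforms of the same [L0], so they differ by the transform with [D h];
    eigenvectors at time t + h are thus produced from L at time t. *)
Lemma transform_eigen h : normc h < d -> forall V Z : 'cV[C]_m,
  Lset Jt (P t) (V, Z) ->
  toC (J (t + h)) *m V + real_biv (P (t + h)) *m (Z + D h *m V) = - 'i *: V /\
  toC (J (t + h)) *m conj_mx V
    + real_biv (P (t + h)) *m conj_mx (Z + D h *m V) = 'i *: conj_mx V.
Proof.
move=> hd V Z VZ.
suff H : Lset (J (t + h)) (P (t + h)) (V, Z + D h *m V).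
  by split; [exact: (Lset_eigen (JP hd) H)|exact: (Lset_eigen_conj (JP hd) H)].
have Lt : Lset Jt (P t) = Btransform (B t) @` L0.
  by have := LB (h := 0); rewrite addr0 (normc0 R); apply.
move: VZ; rewrite Lt LB // => -[[V0 Z0] L00 [<- <-]] /=.
exists (V0, Z0) => //; rewrite /Btransform /= /D mulmxBl.
by rewrite -addrA (addrC (form_map (B t) *m V0)) subrK.
Qed.

(** The minus sign arises because [form_map] transposes and [B] is skew. *)
Lemma expansion_D : expansion D 0 (- a) 0.
Proof.
have H := expansionD (expansionZ (-1) Ba) (expansion_cst (B t)).
have BTt : (B t)^T = - B t.
  by have := BT (h := 0); rewrite addr0 (normc0 R); apply.
have {H} H : expansion D ((-1) *: B t + B t) ((-1) *: a + 0) ((-1) *: 0 + 0).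
  apply: expansion_local d0 _ H => h hd.
  by rewrite /D /form_map BT // BTt scaleN1r opprK.
by apply: expansion_eq H _ _ _; rewrite ?scaler0 ?scaleN1r ?addNr ?addr0.
Qed.

Lemma expansion_Db : expansion (fun h => conj_mx (D h)) 0 0 (- ab).
Proof.
apply: expansion_eq (expansion_conj expansion_D) _ _ _.
- by rewrite /conj_mx map_mx0.
- by rewrite /conj_mx map_mx0.
- by rewrite conj_mxN.
Qed.

Lemma expansion_N : expansion N 0 (- (a *m pr01 Jt)) (- (ab *m pr10 Jt)).
Proof.
apply: expansion_eq (expansionD (expansionM expansion_D (expansion_cst (pr01 Jt)))
  (expansionM expansion_Db (expansion_cst (pr10 Jt)))) _ _ _;
  by rewrite ?mulmx0 ?mul0mx ?addr0 ?add0r ?mulNmx.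
Qed.

Lemma expansion_W : expansion W 0 (- (a *m (p - pb))) (ab *m (p - pb)).
Proof.
have H := expansionD expansion_D (expansionZ (-1) expansion_Db).
apply: expansion_local d0 _ (expansion_eq
  (expansionM H (expansion_cst (p - pb))) _ _ _).
- by move=> h _; rewrite scaleN1r.
- by rewrite scaler0 addr0 mul0mx.
- by rewrite scaler0 !addr0 mulmx0 addr0 mulNmx.
- by rewrite scalerN scaleN1r opprK add0r mulmx0 addr0.
Qed.

(** [transform_biv] makes Q_{t+h} a solution of Q (1 + W) = Q_t with W small, the situation of
    [expansion_solve]. *)
Lemma expansion_real_biv : expansion (fun h => real_biv (P (t + h)))
  (real_biv (P t)) (real_biv (P t) *m (a *m (p - pb)))
  (- (real_biv (P t) *m (ab *m (p - pb)))).
Proof.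
have H h (hd : normc h < d) :
    real_biv (P (t + h)) *m (1%:M + W h) = real_biv (P t).
  exact: (transform_biv JPt (transform_eigen hd)).
apply: expansion_eq (expansion_solve d0 H expansion_W) _ _ _ => //.
by rewrite mulmxN opprK.
Qed.

Lemma expansion_J : expansion (fun h => toC (J (t + h))) (toC Jt)
  (real_biv (P t) *m (a *m pr01 Jt)) (real_biv (P t) *m (ab *m pr10 Jt)).
Proof.
have H := expansionD (expansion_cst (toC Jt))
  (expansionZ (-1) (expansionM expansion_real_biv expansion_N)).
apply: expansion_local d0 _ (expansion_eq H _ _ _).
- move=> h hd; rewrite scaleN1r.
  exact: (transform_complex_structure JPt (transform_eigen hd)).
- by rewrite mulmx0 scaler0 addr0.
- by rewrite mulmx0 !add0r mulmxN scaleN1r opprK.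
- by rewrite mulmx0 !add0r mulmxN scaleN1r opprK.
Qed.

(* Differentiate I_t^2 = -1. *)
Lemma conj_biv_derivative : pb *m a *m pr01 Jt = 0.
Proof.
have H := expansionM expansion_J expansion_J.
have {H} H : expansion (fun=> - 1%:M) (toC Jt *m toC Jt)
    (real_biv (P t) *m (a *m pr01 Jt) *m toC Jt
      + toC Jt *m (real_biv (P t) *m (a *m pr01 Jt)))
    (real_biv (P t) *m (ab *m pr10 Jt) *m toC Jt
      + toC Jt *m (real_biv (P t) *m (ab *m pr10 Jt))).
  by apply: expansion_local d0 _ H => h hd; rewrite (toC_sqr (JP hd)).
rewrite (toC_sqr JPt) in H.
have [+ _] := expansion_unique H (expansion_cst (- 1%:M)).
move=> E; rewrite -mulmxA.
(* Here X is alpha pr01, and pr01 I_t = -i pr01. *)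
apply: anticommuting_derivative (toC_biv JPt) (toC_conj_biv JPt) _ E.
by rewrite -mulmxA (pr01_toC JPt) -scalemxAr.
Qed.

Lemma biv_conj_derivative : p *m ab *m pr10 Jt = 0.
Proof.
have := congr1 (@conj_mx R m m) conj_biv_derivative.
by rewrite !conj_mxM conj_mxK conj_pr01 {2}/conj_mx map_mx0.
Qed.

Lemma expansion_pr10 : expansion (fun h => pr10 (J (t + h))) (pr10 Jt)
  (- (p *m a *m pr01 Jt)) (pb *m ab *m pr10 Jt).
Proof.
have H := expansionZ 2%:R^-1 (expansionD (expansion_cst 1%:M)
  (expansionZ (- 'i) expansion_J)).
apply: expansion_local d0 _ (expansion_eq H _ _ _).
- by move=> h hd; rewrite /pr10 scaleNr.
- by rewrite /pr10 scaleNr.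
- exact: half_derivative10 conj_biv_derivative.
- exact: half_derivative01 biv_conj_derivative.
Qed.

(** The product rule is applied to sigma = (i/2) pr10 Q, both factors being already expanded. *)
Lemma expansion_biv : expansion (fun h => biv_map (P (t + h))) p
  (p *m a *m p) (pb *m ab *m p + p *m ab *m pb).
Proof.
have H := expansionZ (2%:R^-1 * 'i) (expansionM expansion_pr10 expansion_real_biv).
apply: expansion_local d0 _ (expansion_eq H _ _ _).
- by move=> h hd; rewrite {1}(biv_real (JP hd)).
- by rewrite -(biv_real JPt).
- apply: biv_derivative.
  + exact: pr10_biv JPt.
  + exact: pr10_conj_biv JPt.
  + exact: pr01_biv JPt.
  + exact: pr01_conj_biv JPt.
- apply: biv_derivative_conj.
  + exact: pr10_biv JPt.
  + exact: pr10_conj_biv JPt.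
  + exact: biv_conj_derivative.
Qed.

Lemma conj_part11 : conj_mx (part11 Jt a) =
  (pr01 Jt)^T *m ab *m pr10 Jt + (pr10 Jt)^T *m ab *m pr01 Jt.
Proof.
rewrite /part11 -conj_pr10 -conj_pr01 -!conj_tr.
by rewrite conj_mxD !conj_mxM !conj_mxK.
Qed.

Lemma poisson_family_derivatives :
  [/\ is_dt_mx B t a,
      is_dt_mx (fun s => toC (J s)) t
        ((- 2%:R * 'i) *: biv_contract (P t) (part11 Jt a)),
      is_dt_mx P t (wedge2 (P t) (part20 Jt a)) &
      is_dtbar_mx (fun s => biv_map (P s)) t
        (biv_contract (conj_mx (P t)) (conj_mx (part11 Jt a)) *m biv_map (P t)
         + biv_contract (P t) (conj_mx (part11 Jt a))
           *m biv_map (conj_mx (P t)))].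
Proof.
split.
- exact: expansion_is_dt Ba.
(* The contraction reduces to sigma alpha pr01. In the expansion of I the conjugate half of Q
   contributes nothing, by [conj_biv_derivative]. *)
- have -> : (- 2%:R * 'i) *: biv_contract (P t) (part11 Jt a)
      = real_biv (P t) *m (a *m pr01 Jt).
    rewrite /biv_contract (biv_mul11 _ _ _ (biv_pr10 JPt) (biv_pr01 JPt)).
    by rewrite /real_biv -scalemxAl mulmxBl !mulmxA conj_biv_derivative subr0.
  exact: (@expansion_is_dt _ _ (fun s => toC (J s)) _ _ _ _ expansion_J).
- have H : expansion (fun h => P (t + h)) (P t) (wedge2 (P t) (part20 Jt a))
      (pb *m ab *m p + p *m ab *m pb)^T.
    apply: expansion_local d0 _ (expansion_eq (expansion_tr expansion_biv) _ _ _).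
    + by move=> h _; rewrite /biv_map trmxK.
    + by rewrite /biv_map trmxK.
    (* Transposing back from [biv_map] produces three signs, from the two factors sigma and from
       alpha; the remaining one is absorbed by the transpose in [wedge2]. *)
    + rewrite !trmx_mul (biv_tr JPt) derivative_antisym mulmxN mulNmx mulmxN.
      rewrite opprK mulNmx mulmxN mulmxA.
      exact: biv_mul20 (pr10_biv JPt) _ (biv_pr10 JPt) (biv_tr JPt).
    + by [].
  exact: expansion_is_dt H.
- have -> : biv_contract (conj_mx (P t)) (conj_mx (part11 Jt a)) *m p
         + biv_contract (P t) (conj_mx (part11 Jt a)) *m biv_map (conj_mx (P t))
       = pb *m ab *m p + p *m ab *m pb.
    rewrite /biv_contract.
    have -> : biv_map (conj_mx (P t)) = pb by rewrite /biv_map conj_tr.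
    rewrite conj_part11; apply: biv_mul11_conj.
    + exact: pr10_biv JPt.
    + exact: pr01_conj_biv JPt.
    + exact: biv_pr10 JPt.
    + exact: biv_pr01 JPt.
    + exact: conj_biv_pr01 JPt.
    + exact: conj_biv_pr10 JPt.
  exact: (@expansion_is_dtbar _ _ (fun s => biv_map (P s)) _ _ _ _ expansion_biv).
Qed.

End PoissonFamily.

(** * Application to the family on the manifold, one chart and point at a time *)

Lemma holomorphic_Poisson_point (R : realType) (n : nat) (M : manifold R n.*2)
    (I : rfield2 M) (sigma : field2 M) c p :
  holomorphic_Poisson I sigma -> dom c p -> poisson_point (I c p) (sigma c p).
Proof. by move=> [[_ II _] [_ sT _] Is _ _] cp; split; [apply: II|apply: sT|apply: Is]. Qed.

Theorem theorem6p2
  (R : realType) (n : nat) (M : manifold R n.*2)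
  (hM : compact [set: M])
  (I : rfield2 M) (sigma : field2 M)
  (hIsigma : holomorphic_Poisson I sigma)
  (hsurj : H2_to_H2O_surjective I)
  (omega1 : field2 M)
  (homega1 : closed_form2 omega1)
  (homega1_02 : forall c p, dom c p -> part02 (I c p) (omega1 c p) = 0)
  (g : rfield2 M) (hg : hermitian_metric I g)
  (vol : (M -> R) -> R) (hvol : riemannian_integral g vol)
  (H : field2 M -> Prop) (hH : splitting I H)
  (b : nat -> field2 M)
  (hb : inductive_construction g vol I sigma H omega1 b)
  (U : set R[i]) (hU : open_subset U) (hU0 : U 0)
  (beta : R[i] -> field2 M)
  (hbeta_closed : forall t, U t -> closed_form2 (beta t))
  (hbeta : forall t, U t -> forall c p, dom c p ->
     power_series_value (fun k => b k c p) t (beta t c p))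
  (I_ : R[i] -> rfield2 M) (sigma_ : R[i] -> field2 M)
  (hIsigma_ : forall t, U t -> holomorphic_Poisson (I_ t) (sigma_ t))
  (hL : forall t, U t -> forall c p, dom c p ->
     Lset (I_ t c p) (sigma_ t c p) =
     Btransform (beta t c p) @` Lset (I c p) (sigma c p)) :
  forall t, U t -> forall c p, dom c p ->
    exists alpha : 'M[R[i]]_(n.*2),
      let It := I_ t c p in
      let st := sigma_ t c p in
      [/\ is_dt_mx (fun s => beta s c p) t alpha,
          is_dt_mx (fun s => toC (I_ s c p)) t
            ((- 2%:R * 'i) *: biv_contract st (part11 It alpha)),
          is_dt_mx (fun s => sigma_ s c p) t
            (wedge2 st (part20 It alpha)) &
          is_dtbar_mx (fun s => biv_map (sigma_ s c p)) t
            (biv_contract (conj_mx st) (conj_mx (part11 It alpha)) *m biv_map st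
             + biv_contract st (conj_mx (part11 It alpha))
               *m biv_map (conj_mx st))].
Proof.
move=> t Ut c p cp.
have [e e0 He] := hU t Ut.
have {}He s : normc (s - t) < e -> U s.
  by move=> se; apply: He; rewrite normr_normc ltcR.
have Hh h : normc h < e -> U (t + h).
  by move=> he; apply: He; rewrite addrC addKr.
(* alpha is the linear coefficient of beta at t; the expansion needs the power series on a whole
   disc around t, which openness of [U] provides. *)
have [a Ha] := power_series_mx_expansion e0 (fun s se => hbeta s (He s se) c p cp).
exists a; apply: (@poisson_family_derivatives _ _ (fun s => I_ s c p)
  (fun s => sigma_ s c p) (fun s => beta s c p) t e (Lset (I c p) (sigma c p))) => //.
- by move=> h /Hh /hIsigma_ /holomorphic_Poisson_point; apply.
- by move=> h /Hh /hbeta_closed [[_ bT _] _]; apply: bT.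
- by move=> h /Hh Uh; apply: hL.
Qed.
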